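(* Assume that $(\Omega,\mathcal F_t,\mathrm P|_{\mathcal F_t})$ is atomless for every $t>0$, that $Y^*\in\mathcal L^1(\mathcal Q)$, and that $\sup_{\mathrm Q\in\mathcal Q}\mathbb E_{\mathrm Q}[Y^*\mathbb 1_{\{Y^*>a\}}]\to0$ as $a\to\infty$. Let $d$ be a totally bounded semimetric on $\mathcal Q$ such that the process $(d\mathrm Q/d\mathrm P)_{\mathrm Q\in\mathcal Q}$ has $\mathrm P$-almost surely $d$-uniformly continuous paths and is dominated by some $\mathrm P$-integrable random variable. Then $$\sup_{\tau\in\mathcal T}\inf_{\mathrm Q\in\mathcal Q}\mathbb E_{\mathrm Q}[Y_\tau]=\sup_{\tau\in\mathcal T}\inf_{\mathrm Q\in co(\mathcal Q)}\mathbb E_{\mathrm Q}[Y_\tau]=\inf_{\mathrm Q\in co(\mathcal Q)}\sup_{\tau\in\mathcal T}\mathbb E_{\mathrm Q}[Y_\tau].$$ If in addition $L^1(\Omega,\mathcal F_t,\mathrm P|_{\mathcal F_t})$ is weakly separable for every $t>0$, then $\mathcal Q$ is not time-consistent whenever $\mathcal Q$ has more than one element and all elements of $\mathcal Q$ are equivalent to $\mathrm P$.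
   Context: Let $0<T<\infty$ and let $(\Omega,\mathcal F,(\mathcal F_t)_{0\le t\le T},\mathrm P)$ be a filtered probability space with right-continuous filtration, $\mathcal F=\mathcal F_T$, and $\mathcal F_0$ containing only sets of probability $0$ or $1$ as well as all $\mathrm P$-null sets of $\mathcal F_T$. $\mathcal T$ denotes the set of all stopping times $\tau\le T$ w.r.t. $(\mathcal F_t)$. $\mathcal Q$ is a nonempty set of probability measures on $\mathcal F$, each absolutely continuous w.r.t. $\mathrm P$, and $co(\mathcal Q)$ is its convex hull. $\mathcal L^1(\mathcal Q)$ is the set of random variables $X$ with $\sup_{\mathrm Q\in\mathcal Q}\mathbb E_{\mathrm Q}[|X|]<\infty$. $Y=(Y_t)_{0\le t\le T}$ is a right-continuous $(\mathcal F_t)$-adapted process with bounded paths which is quasi left-uppersemicontinuous w.r.t. $\mathrm P$, i.e. $\limsup_n Y_{\tau_n}\le Y_\tau$ $\mathrm P$-a.s. whenever $\tau_n\in\mathcal T$, $\tau_n\nearrow\tau\in\mathcal T$. $Y^*:=\sup_{t\in[0,T]}|Y_t|$. The set $\mathcal Q$ is called time-consistent if for all $\tau,\sigma\in\mathcal T$ with $\tau\le\sigma$ and all $\mathrm P$-essentially bounded $X,Z$: $\operatorname{ess\,inf}_{\mathrm Q\in\mathcal Q}\mathbb E_{\mathrm Q}[X|\mathcal F_\sigma]\le\operatorname{ess\,inf}_{\mathrm Q\in\mathcal Q}\mathbb E_{\mathrm Q}[Z|\mathcal F_\sigma]$ implies $\operatorname{ess\,inf}_{\mathrm Q\in\mathcal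 Q}\mathbb E_{\mathrm Q}[X|\mathcal F_\tau]\le\operatorname{ess\,inf}_{\mathrm Q\in\mathcal Q}\mathbb E_{\mathrm Q}[Z|\mathcal F_\tau]$. *)

(* Defs.v *)
From HB Require Import structures.
From mathcomp Require Import all_boot all_order all_algebra.
From mathcomp Require Import all_classical all_reals all_analysis.
Set Implicit Arguments. Unset Strict Implicit. Unset Printing Implicit Defensive.
Import Order.TTheory GRing.Theory Num.Theory.
Import numFieldNormedType.Exports.
Local Open Scope classical_set_scope.
Local Open Scope ring_scope.

Section defs.
Context {d : measure_display} {Om : measurableType d} {R : realType}.
Implicit Types (P Q : probability Om R) (G : set (set Om)).

Definition measurable_wrt G (X : Om -> R) :=
  forall B : set R, measurable B -> G (X @^-1` B).

Definition usual_filtration P (Tend : R) (F : R -> set (set Om)) :=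
  [/\ (forall t, 0 <= t <= Tend -> sigma_algebra setT (F t)),
      (forall t, 0 <= t <= Tend -> F t `<=` measurable),
      (forall s t, 0 <= s -> s <= t -> t <= Tend -> F s `<=` F t),
      (forall t, 0 <= t < Tend ->
          F t = \bigcap_(s in [set s | t < s <= Tend]) F s) &
      [/\ F Tend = measurable,
       (forall A, F 0 A -> P A = 0%E \/ P A = 1%E) &
       (forall A, measurable A -> P A = 0%E -> F 0 A)]].

Definition stopping_time (Tend : R) (F : R -> set (set Om)) (tau : Om -> R) :=
  (forall w, 0 <= tau w <= Tend) /\
  (forall t, 0 <= t <= Tend -> F t [set w | tau w <= t]).

Definition stopped_sigma (Tend : R) (F : R -> set (set Om)) (sig : Om -> R) :
  set (set Om) :=
  [set A | measurable A /\
     forall t, 0 <= t <= Tend -> F t (A `&` [set w | sig w <= t])].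

Definition stopped (Y : R -> Om -> R) (tau : Om -> R) : Om -> R :=
  fun w => Y (tau w) w.

Definition Ystar (Tend : R) (Y : R -> Om -> R) : Om -> R :=
  fun w => sup [set `|Y t w| | t in `[0, Tend]].

Definition abs_cont Q P := forall A, measurable A -> P A = 0%E -> Q A = 0%E.
Definition equiv_meas Q P := abs_cont Q P /\ abs_cont P Q.

Definition conv_hull (Qs : set (probability Om R)) : set (probability Om R) :=
  [set mu | exists (n : nat) (w : 'I_n -> R) (Qi : 'I_n -> probability Om R),
     [/\ (forall i, 0 <= w i), \sum_(i < n) w i = 1, (forall i, Qs (Qi i)) &
         forall A, measurable A -> mu A = (\sum_(i < n) (w i)%:E * Qi i A)%E]].

Definition is_density P Q (f : Om -> R) :=
  [/\ measurable_fun setT f, (forall w, 0 <= f w) &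
      forall A, measurable A -> Q A = (\int[P]_(w in A) (f w)%:E)%E].

Definition semimetric_on (Qs : set (probability Om R))
    (dist : probability Om R -> probability Om R -> R) :=
  forall Q1 Q2 Q3, Qs Q1 -> Qs Q2 -> Qs Q3 ->
    [/\ 0 <= dist Q1 Q2, dist Q1 Q1 = 0, dist Q1 Q2 = dist Q2 Q1 &
        dist Q1 Q3 <= dist Q1 Q2 + dist Q2 Q3].

Definition totally_bounded_on (Qs : set (probability Om R))
    (dist : probability Om R -> probability Om R -> R) :=
  forall eps : R, 0 < eps -> exists s : seq (probability Om R),
    (forall Q', Q' \in s -> Qs Q') /\
    forall Q, Qs Q -> exists2 Q', Q' \in s & dist Q Q' < eps.

Definition atomless_on P G :=
  forall A, G A -> (0 < P A)%E ->
    exists B, [/\ G B, B `<=` A & (0 < P B < P A)%E].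

(** weak separability of L^1(Om, G, P|_G): there is a countable subset D
    which is dense for the weak topology sigma(L^1, L^oo) *)
Definition L1_on P G (X : Om -> R) :=
  measurable_wrt G X /\ P.-integrable setT (EFin \o X).
Definition Linf_on P G (Z : Om -> R) :=
  measurable_wrt G Z /\ exists M : R, {ae P, forall w, `|Z w| <= M}.
Definition weakly_separable_L1 P G :=
  exists D : nat -> Om -> R, (forall n, L1_on P G (D n)) /\
    forall X, L1_on P G X ->
    forall (k : nat) (Z : 'I_k -> Om -> R), (forall i, Linf_on P G (Z i)) ->
    forall eps : R, 0 < eps -> exists n : nat, forall i : 'I_k,
      (`| \int[P]_w (((X w - D n w) * Z i w)%:E) | < eps%:E)%E.

Definition cond_exp Q G (X Z : Om -> R) :=
  [/\ measurable_wrt G Z, Q.-integrable setT (EFin \o Z) &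
      forall A, G A ->
        (\int[Q]_(w in A) (Z w)%:E = \int[Q]_(w in A) (X w)%:E)%E].

Definition ess_inf_of P {I : Type} (Ix : set I) (Z : I -> Om -> R)
    (W : Om -> R) :=
  [/\ measurable_fun setT W,
      (forall i, Ix i -> {ae P, forall w, W w <= Z i w}) &
      (forall W' : Om -> R, measurable_fun setT W' ->
         (forall i, Ix i -> {ae P, forall w, W' w <= Z i w}) ->
         {ae P, forall w, W' w <= W w})].

Definition ess_bounded P (X : Om -> R) :=
  measurable_fun setT X /\ exists M : R, {ae P, forall w, `|X w| <= M}.

(** time-consistency of Qs; since conditional expectations and essential
    infima are only defined up to null sets, the implication is required
    for all versions of them *)
Definition time_consistent P (Tend : R) (F : R -> set (set Om))
    (Qs : set (probability Om R)) :=
  forall tau sig : Om -> R,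
    stopping_time Tend F tau -> stopping_time Tend F sig ->
    (forall w, tau w <= sig w) ->
  forall X Z : Om -> R, ess_bounded P X -> ess_bounded P Z ->
  forall (CXs CZs CXt CZt : probability Om R -> Om -> R)
         (WXs WZs WXt WZt : Om -> R),
    (forall Q, Qs Q -> cond_exp Q (stopped_sigma Tend F sig) X (CXs Q)) ->
    (forall Q, Qs Q -> cond_exp Q (stopped_sigma Tend F sig) Z (CZs Q)) ->
    (forall Q, Qs Q -> cond_exp Q (stopped_sigma Tend F tau) X (CXt Q)) ->
    (forall Q, Qs Q -> cond_exp Q (stopped_sigma Tend F tau) Z (CZt Q)) ->
    ess_inf_of P Qs CXs WXs -> ess_inf_of P Qs CZs WZs ->
    ess_inf_of P Qs CXt WXt -> ess_inf_of P Qs CZt WZt ->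
    {ae P, forall w, WXs w <= WZs w} ->
    {ae P, forall w, WXt w <= WZt w}.

End defs.

(* Main.v *)
(** Uniform continuity, domination and total boundedness make the set of densities
    totally bounded in L^1(P).  Together with uniform integrability this reduces the
    minimax equality, up to epsilon, to finitely many measures Q_1, ..., Q_n.  For these,
    the set of vectors (E_{Q_i}[Y_tau])_i is approximately midpoint convex: in an atomless
    F_t there are pairwise independent events of probability 1/2, and by Bessel's
    inequality one of them, A, is almost uncorrelated with finitely many given variables;
    following tau_1 on A and tau_2 off A, both delayed to t, gives nearly the average
    payoff as t -> 0.  An elementary minimax theorem for such subsets of R^n concludes.

    For the second part, let C_Q be the conditional probability of an event A given F_t
    under Q, and L, U the essential infimum and supremum of the C_Q.  If r = +-1 is
    F_t-measurable and almost uncorrelated with everything relevant, the conditional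
    essential infimum of r 1_A is r (L + U) / 2 + (L - U) / 2, so consistency between 0 and
    t gives inf_Q E_Q[r 1_A] <= E_Q[r (L + U) / 2] - E_Q[U - L] / 2 for each Q, hence U = L
    in the limit: all Q share one conditional probability of A.  For A = {f_1 < f_2} with
    densities f_1, f_2 of two elements, this forces L = 1 on {f_1 < f_2} and L = 0 on
    {f_2 < f_1}.  Letting t -> 0 yields an event of the trivial sigma-algebra F_0
    separating these two sets, so one of them is null and the two measures agree. *)
Require Import Defs.
From HB Require Import structures.
From mathcomp Require Import all_boot all_order all_algebra.
From mathcomp Require Import all_classical all_reals all_analysis.
From mathcomp Require Import numfun measurable_realfun.
From mathcomp Require Import lra ring.
Import Order.TTheory GRing.Theory Num.Theory.
Import numFieldNormedType.Exports.
Local Open Scope classical_set_scope.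
Local Open Scope ring_scope.
Set Implicit Arguments.
Unset Strict Implicit.
Unset Printing Implicit Defensive.

(** * Minimax for approximately convex sets *)

Section approximate_minimax.
Variables (R : realType) (n : nat) (S : set ('I_n -> R)).
Hypothesis S_midpoint : forall x y (e : R), S x -> S y -> 0 < e ->
  exists2 z, S z & forall i, `|z i - (x i + y i) / 2| <= e.

(** The approximate midpoint of [x] and the previous point halves both the coefficient and the
    inherited error. Precision [e / 2] at both places therefore keeps the total error below [e]. *)
Lemma approx_dyadic_point k x y (e : R) : S x -> S y -> 0 < e ->
  exists2 z, S z & forall i, `|z i - (x i + 2^-1 ^+ k * (y i - x i))| <= e.
Proof.
move=> Sx Sy; elim: k e => [|k IH] e e0.
  exists y => // i; rewrite expr0 mul1r.
  have -> : y i - (x i + (y i - x i)) = 0 by ring.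
  by rewrite normr0 ltW.
have e2 : 0 < e / 2 by rewrite divr_gt0.
have [u Su uE] := IH _ e2; have [z Sz zE] := S_midpoint Sx Su e2.
exists z => // i; move: (zE i) (uE i); rewrite exprS.
rewrite -mulrA; move: (_ ^+ k * (y i - x i)) => q.
rewrite !ler_norml => /andP[? ?] /andP[? ?]; apply/andP; split; lra.
Qed.

(* Blackwell's argument: at a near-minimiser [x] of the squared distance to the
   orthant [{y | forall i, c <= y i}], moving towards a point that is good for the
   weights [max 0 (c - x i)] would decrease the distance too much. *)
Lemma approx_minimax (M c e : R) :
  S !=set0 -> (forall x i, S x -> `|x i| <= M) ->
  (forall w : 'I_n -> R, (forall i, 0 <= w i) -> \sum_i w i = 1 ->
     exists2 x, S x & c <= \sum_i w i * x i) ->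
  0 < e -> exists2 x, S x & forall i, c - e <= x i.
Proof.
move=> [x0 Sx0] SM Sw e0; apply: contrapT => noS.
have M0 : 0 <= M.
  apply: contrapT => /negP; rewrite -ltNge => Mlt0; apply: noS; exists x0 => // i.
  by have := le_trans (normr_ge0 _) (SM _ i Sx0); rewrite leNgt Mlt0.
(* [w x] is the vector of deficits below [c], and [phi] below is the squared distance to the
   orthant. The normalised deficits are the weights fed to [Sw]. *)
pose w (x : 'I_n -> R) i : R := Num.max 0 (c - x i).
have w0 x i : 0 <= w x i by rewrite le_max lexx.
have wB x i : S x -> w x i <= `|c| + M.
  move=> Sx; rewrite ge_max addr_ge0//=.
  by have := SM _ i Sx; have := ler_norm c; rewrite ler_norml => ? /andP[? ?]; lra.
pose phi x : R := \sum_i w x i ^+ 2.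
have phie x : S x -> e ^+ 2 <= phi x.
  move=> Sx; have [i xi] : exists i, x i < c - e.
    apply: contrapT => nex; apply: noS; exists x => // i.
    by rewrite leNgt; apply/negP => ?; apply: nex; exists i.
  rewrite /phi (bigD1 i)//= -[leLHS]addr0 lerD ?sumr_ge0// => [|*].
    by rewrite ler_sqr ?nnegrE ?(ltW e0)// /w le_max; apply/orP; right; lra.
  exact: sqr_ge0.
pose I := [set phi x | x in S]; pose dl := inf I.
have infI : has_inf I.
  split; first by exists (phi x0); exists x0.
  by exists (e ^+ 2) => _ [x Sx <-]; exact: phie.
have dl0 : 0 < dl.
  apply: (@lt_le_trans _ _ (e ^+ 2)); first by rewrite exprn_gt0.
  by apply: lb_le_inf; [exact: infI.1 | move=> _ [x Sx <-]; exact: phie].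
(* [K] collects the terms of order [s ^+ 2]: per coordinate, the square of a displacement of at most
   [s * (2 * M + 1)], and twice an approximation error [s ^+ 2] times a deficit of at most
   [|c| + M]. *)
pose K := n%:R * ((2 * M + 1) ^+ 2 + 2 * (`|c| + M)).
have [k kK] : exists k, 2^-1 ^+ k * K <= dl.
  have : (fun k => 2^-1 ^+ k * K) @ \oo --> (0 * K : R).
    by apply: cvgMl; apply: cvg_expr; rewrite ger0_norm ?invr_ge0// invf_lt1// ltr1n.
  rewrite mul0r => /cvgrPdist_le /(_ _ dl0) [N _ /(_ N (leqnn _))] /=.
  by rewrite sub0r normrN => h; exists N; apply: le_trans h; rewrite ler_norm.
pose s : R := 2^-1 ^+ k.
have s0 : 0 < s by rewrite exprn_gt0// invr_gt0.
have s1 : s <= 1 by rewrite exprn_ile1// ?invr_ge0// invf_le1// ler1n.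
(* With [phi x] within [s * dl] of the infimum, a first-order gain of at least [2 * s * dl] against
   a second-order loss of at most [s * dl] brings the value below [dl]. *)
have [_ [x Sx <-] xdl] : exists2 v, I v & v < dl + s * dl.
  by apply: inf_adherent => //; rewrite mulr_gt0.
have W0 : 0 < \sum_i w x i.
  rewrite lt_neqAle sumr_ge0// andbT eq_sym; apply/eqP => W0.
  have := phie x Sx; rewrite leNgt => /negP; apply.
  rewrite (_ : phi x = 0) ?exprn_gt0// /phi big1// => i _.
  by have /eqP := W0; rewrite psumr_eq0// => /allP/(_ i);
     rewrite mem_index_enum => /(_ isT)/eqP ->; rewrite expr0n.
have [y Sy yc] : exists2 y, S y & 0 <= \sum_i w x i * (y i - c).
  have [||y Sy cy] := Sw (fun i => w x i / \sum_i w x i).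
  - by move=> i; rewrite divr_ge0// ltW.
  - by rewrite -mulr_suml divff// gt_eqF.
  exists y => //.
  under eq_bigr do rewrite mulrBr.
  rewrite big_split/= sumrN -mulr_suml subr_ge0 mulrC -ler_pdivlMr//.
  by rewrite mulr_suml; apply: (le_trans cy); apply: ler_sum => i _; rewrite mulrAC.
(* The precision [s ^+ 2] makes the error of the dyadic point a second-order term. *)
have [z Sz zE] := approx_dyadic_point k Sx Sy (exprn_gt0 2 s0).
have : phi z < dl; last first.
  by rewrite ltNge => /negP; apply; apply: ge_inf; [exact: infI.2 | exists z].
suff : phi z <= phi x - 2 * s * \sum_i w x i * (y i - x i) + s ^+ 2 * K.
  move=> /le_lt_trans; apply.
  have : phi x <= \sum_i w x i * (y i - x i).
    have -> : \sum_i w x i * (y i - x i) =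
        \sum_i w x i * (y i - c) + \sum_i w x i * (c - x i).
      by rewrite -big_split/=; apply: eq_bigr => i _; ring.
    rewrite -[leLHS]add0r lerD//; apply: ler_sum => i _.
    by rewrite expr2 /w; case: (leP 0 (c - x i)) => h; rewrite ?mul0r.
  have : dl <= phi x by apply: ge_inf; [exact: infI.2 | exists x].
  move: xdl kK; rewrite -/s; move: (phi x) (\sum_i w x i * (y i - x i)) => p q.
  move=> h1 h2 h3 h4; nra.
have -> : s ^+ 2 * K = \sum_(i < n) s ^+ 2 * ((2 * M + 1) ^+ 2 + 2 * (`|c| + M)).
  by rewrite sumr_const card_ord /K mulrCA [n%:R * _]mulr_natl.
rewrite /phi mulr_sumr -sumrB.
rewrite -big_split/=; apply: ler_sum => i _.
(* Truncation at 0 only helps: where [x i] already exceeds [c], the deficit of [z] is at most its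
   displacement from [x]. *)
have wz : w z i ^+ 2 <= (w x i - (z i - x i)) ^+ 2.
  rewrite /w; case: (leP 0 (c - z i)) => h; case: (leP 0 (c - x i)) => h';
    rewrite ?expr0n/= ?sqr_ge0//.
    - by rewrite (_ : c - x i - (z i - x i) = c - z i) //; ring.
    - by rewrite ler_sqr ?nnegrE; lra.
apply: (le_trans wz).
have /(_ i) := zE; set h := z i - (x i + _); rewrite -/s => hs.
have zh : z i - x i = s * (y i - x i) + h by rewrite /h -/s; ring.
rewrite zh; move: (w0 x i) (wB x i Sx) (SM _ i Sx) (SM _ i Sy) hs => a0 aB xM yM hs.
move: (w x i) (y i) (x i) h a0 aB xM yM hs {zh wz} => a yi xi h a0 aB xM yM hs.
have ss : s ^+ 2 <= s by rewrite expr2 -[leRHS]mulr1 ler_wpM2l// ltW.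
have : `|s * (yi - xi) + h| <= s * (2 * M + 1).
  apply: (le_trans (ler_normD _ _)); rewrite normrM (gtr0_norm s0) mulrDr mulr1.
  apply: lerD; last exact: le_trans hs ss.
  by rewrite ler_wpM2l ?(ltW s0)// (le_trans (ler_normB _ _))//; lra.
rewrite -ler_sqr ?nnegrE ?normr_ge0//; last by rewrite mulr_ge0 ?(ltW s0)//; lra.
rewrite real_normK ?num_real// exprMn => q.
have : - (a * h) <= s ^+ 2 * (`|c| + M).
  apply: (@le_trans _ _ `|a * h|); first by rewrite -normrN ler_norm.
  by rewrite normrM (ger0_norm a0) mulrC ler_pM.
move: (`|c| + M) => B q2; lra.
Qed.

End approximate_minimax.

(** * Atomless probability spaces *)

Section sigma_algebra_closure.
Variables (T : Type) (G : set (set T)).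
Hypothesis sG : sigma_algebra setT G.

Lemma salgebra_set0 : G set0. Proof. by case: sG. Qed.

Lemma salgebra_setC A : G A -> G (~` A).
Proof. by case: sG => _ + _ => /[apply]; rewrite setTD. Qed.

Lemma salgebra_setT : G setT.
Proof. by rewrite -setC0; exact/salgebra_setC/salgebra_set0. Qed.

Lemma salgebra_bigcup (A : (set T)^nat) :
  (forall n, G (A n)) -> G (\bigcup_n A n).
Proof. by case: sG => _ _; exact. Qed.

Lemma salgebra_bigcap (A : (set T)^nat) :
  (forall n, G (A n)) -> G (\bigcap_n A n).
Proof.
move=> GA; rewrite -[X in G X]setCK setC_bigcap; apply/salgebra_setC.
by apply: salgebra_bigcup => n; exact: salgebra_setC.
Qed.

Lemma salgebra_setU A B : G A -> G B -> G (A `|` B).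
Proof.
move=> GA GB; rewrite -bigcup2E; apply: salgebra_bigcup => -[|[|n]]//=.
exact: salgebra_set0.
Qed.

Lemma salgebra_setI A B : G A -> G B -> G (A `&` B).
Proof.
move=> GA GB; rewrite -[X in G X]setCK setCI; apply/salgebra_setC.
by apply: salgebra_setU; exact: salgebra_setC.
Qed.

Lemma salgebra_setD A B : G A -> G B -> G (A `\` B).
Proof. by move=> GA GB; rewrite setDE; apply: salgebra_setI => //; exact: salgebra_setC. Qed.

End sigma_algebra_closure.

(** * Halving events in an atomless sigma-algebra *)

Section real_probability.
Context {d : measure_display} {Om : measurableType d} {R : realType}.
Variable P : probability Om R.
Local Notation pr A := (fine (P A)).

Lemma fineK_probability A : measurable A -> (pr A)%:E = P A.
Proof. by move=> mA; rewrite fineK// fin_num_measure. Qed.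

Lemma fine_probability_ge0 A : 0 <= pr A.
Proof. exact/fine_ge0/measure_ge0. Qed.

Lemma fine_probability_le1 A : measurable A -> pr A <= 1.
Proof. by move=> mA; rewrite -lee_fin fineK_probability// probability_le1. Qed.

Lemma fine_probabilityU A B : measurable A -> measurable B ->
  A `&` B = set0 -> pr (A `|` B) = pr A + pr B.
Proof.
move=> mA mB AB; apply/EFin_inj; rewrite EFinD !fineK_probability//.
  exact: measureU.
exact: measurableU.
Qed.

Lemma fine_probabilityD A B : measurable A -> measurable B -> B `<=` A ->
  pr (A `\` B) = pr A - pr B.
Proof.
move=> mA mB BA; rewrite -{2}(setDUK BA) fine_probabilityU ?setDIK//.
  by rewrite addrAC subrr add0r.
exact: measurableD.
Qed.

Lemma le_fine_probability A B : measurable A -> measurable B -> A `<=` B ->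
  pr A <= pr B.
Proof.
by move=> mA mB AB; rewrite -lee_fin !fineK_probability// le_measure// inE.
Qed.

Variable G : set (set Om).
Hypothesis sG : sigma_algebra setT G.
Hypothesis Gm : G `<=` measurable.
Hypothesis atomG : atomless_on P G.

(** When [B] is split by a subset of smaller positive probability, one of the two pieces has at most
    half the probability of [B]. Repeating this gives positive probabilities below [2^-n]. *)
Lemma atomless_small A (e : R) : G A -> 0 < pr A -> 0 < e ->
  exists2 B, G B & B `<=` A /\ 0 < pr B <= e.
Proof.
move=> GA A0 e0.
have step n : exists2 B, G B & B `<=` A /\ 0 < pr B <= 2^-1 ^+ n.
  elim: n => [|n [B GB [BA /andP[B0 Bn]]]].
    by exists A => //; split=> //; rewrite A0 expr0 fine_probability_le1//; exact: Gm.
  have [|C [GC CB /andP[C0 CB']]] := atomG GB.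
    by rewrite -(fineK_probability (Gm GB)) lte_fin.
  have mB := Gm GB; have mC := Gm GC.
  move: C0 CB'; rewrite -(fineK_probability mC) -(fineK_probability mB) !lte_fin.
  move=> C0 CltB.
  have BC := fine_probabilityD mB mC CB.
  have [h|h] := leP (pr C) (pr B / 2).
    exists C => //; split; first exact: subset_trans BA.
    by rewrite C0 exprS; lra.
  exists (B `\` C); first exact: salgebra_setD.
  split; first by apply: subset_trans BA; exact: subDsetl.
  rewrite BC exprS; apply/andP; split; lra.
have : (fun n => (2^-1 : R) ^+ n) @ \oo --> (0 : R).
  by apply: cvg_expr; rewrite ger0_norm ?invr_ge0// invf_lt1// ltr1n.
move=> /cvgrPdist_le /(_ _ e0) [N _ /(_ N (leqnn _))] /=.
rewrite sub0r normrN => h; have [B GB [BA /andP[B0 BN]]] := step N.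
exists B => //; split=> //; rewrite B0/=.
by apply: (le_trans BN); apply: le_trans h; rewrite ler_norm.
Qed.

(* Greedy exhaustion: add at each step a set of at least half the largest
   admissible probability. *)
Lemma atomless_half A : G A -> exists B, [/\ G B, B `<=` A & pr B = pr A / 2].
Proof.
move=> GA; pose c := pr A / 2.
have c0 : 0 <= c by rewrite divr_ge0// fine_probability_ge0.
pose ok B := [/\ G B, B `<=` A & pr B <= c].
have [f fP] : exists f : set Om -> set Om, forall B, ok B ->
    [/\ ok (f B), B `<=` f B & forall C, G C -> C `<=` A `\` B ->
         pr B + pr C <= c -> pr C <= 2 * (pr (f B) - pr B)].
  suff : forall B, exists B', ok B -> [/\ ok B', B `<=` B' &
    forall C, G C -> C `<=` A `\` B -> pr B + pr C <= c ->
              pr C <= 2 * (pr B' - pr B)].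
    by move=> /choice[f fP]; exists f.
  move=> B; have [okB|nokB] := pselect (ok B); last by exists B.
  have [GB BA Bc] := okB.
  pose ad C := [/\ G C, C `<=` A `\` B & pr B + pr C <= c].
  pose I := [set pr C | C in ad].
  have ad0 : ad set0.
    by split; [exact: salgebra_set0|exact: sub0set|rewrite measure0/= addr0].
  have supI : has_sup I.
    split; first by exists (pr set0); exists set0.
    by exists 1 => _ [C [GC _ _] <-]; exact/fine_probability_le1/Gm.
  have [C [GC CAB Cc] supC] : exists2 C, ad C & sup I <= 2 * pr C.
    (* A positive supremum is more than half attained by some admissible set; otherwise the empty
       set already does. *)
    have [s0|s0] := leP (sup I) 0.
      by exists set0 => //; rewrite (le_trans s0)// mulr_ge0// fine_probability_ge0.
    have [_ [C adC <-] CI] := sup_adherent (divr_gt0 s0 (@ltr0Sn R 1)) supI.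
    by exists C => //; lra.
  have BC : pr (B `|` C) = pr B + pr C.
    apply: fine_probabilityU; [exact: Gm|exact: Gm|].
    by apply/seteqP; split=> // w [Bw /CAB[]].
  exists (B `|` C) => _; split.
  - split; [exact: salgebra_setU| |by rewrite BC].
    by rewrite subUset; split=> // w /CAB[].
  - exact: subsetUl.
  move=> D GD DAB Dc; rewrite BC addrAC subrr add0r; apply: le_trans supC.
  by apply: ub_le_sup; [exact: supI.2|exists D].
pose B n := iter n f set0.
have okB n : ok (B n).
  elim: n => [|n IH]; last by have [] := fP _ IH.
  by split; [exact: salgebra_set0|exact: sub0set|rewrite measure0/=].
have GB n : G (B n) by case: (okB n).
have Bnd : nondecreasing_seq B.
  by apply/nondecreasing_seqP => n; apply/subsetPset; have [] := fP _ (okB n).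
pose U := \bigcup_n B n.
have GU : G U by exact: salgebra_bigcup.
have UA : U `<=` A by move=> w [n _]; have [_ + _] := okB n; exact.
have Uc : pr U <= c.
  rewrite -lee_fin fineK_probability; last exact: Gm.
  have h : P \o B @ \oo --> P U.
    by apply: nondecreasing_cvg_mu => // [n|]; exact: Gm.
  rewrite -(cvg_lim _ h)//; apply: lime_le.
    by apply/cvg_ex; exists (P U).
  apply: nearW => n /=; rewrite -(fineK_probability (Gm (GB n))).
  by rewrite lee_fin; have [] := okB n.
exists U; split=> //; apply/eqP; rewrite eq_le Uc/= leNgt; apply/negP => Ult.
(* If [U] fell short of [c], a small set [C] outside [U] would stay admissible at every stage. Each
   stage would then add at least [pr C / 2], and after [N] stages the probability would exceed 1. *)
have [|||C GC [CAU /andP[C0 Cle]]] := @atomless_small (A `\` U) (c - pr U).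
- exact: salgebra_setD.
- rewrite fine_probabilityD//; [|exact: Gm..].
  by have := fine_probability_ge0 U; rewrite /c in Ult *; lra.
- by rewrite subr_gt0.
have Bn n : n%:R * (pr C / 2) <= pr (B n).
  elim: n => [|n IH]; first by rewrite mul0r fine_probability_ge0.
  have [_ _ fmax] := fP _ (okB n).
  have BU : pr (B n) <= pr U.
    by apply: le_fine_probability; [exact: Gm|exact: Gm|exact: bigcup_sup].
  have {fmax} : pr C <= 2 * (pr (B n.+1) - pr (B n)).
    apply: fmax => //; last by lra.
    by move=> w /CAU[? nU]; split=> // Bw; apply: nU; exists n.
  have -> : n.+1%:R * (pr C / 2) = n%:R * (pr C / 2) + pr C / 2.
    by rewrite -[n.+1]addn1 natrD; ring.
  move: (n%:R * _) IH => q; lra.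
pose N := (Num.truncn (pr C / 2)^-1).+1.
have := Bn N; rewrite leNgt => /negP; apply.
apply: le_lt_trans (fine_probability_le1 (Gm (GB N))) _.
rewrite -ltr_pdivrMr ?divr_gt0// mul1r.
by rewrite truncnS_gt.
Qed.

(** Induction on [N]: [D] is cut by the last set [B N], both pieces are halved compatibly with the
    earlier sets, and the two halves are united. *)
Lemma atomless_halve_seq N (B : nat -> set Om) D : (forall i, G (B i)) -> G D ->
  exists A, [/\ G A, A `<=` D, pr A = pr D / 2 &
    forall i, (i < N)%N -> pr (A `&` B i) = pr (D `&` B i) / 2].
Proof.
move=> GB; elim: N D => [|N IH] D GD.
  by have [A [GA AD A2]] := atomless_half GD; exists A.
have [A1 [GA1 A1D A12 A1i]] := IH _ (salgebra_setI sG GD (GB N)).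
have [A2 [GA2 A2D A22 A2i]] := IH _ (salgebra_setD sG GD (GB N)).
have A1B : A1 `&` B N = A1 by apply/setIidl => w /A1D[].
have A2B : A2 `&` B N = set0.
  by apply/seteqP; split => // w [/A2D[_ nBw] Bw].
have A12I : A1 `&` A2 = set0.
  by apply/seteqP; split => // w [/A1D[_ Bw] /A2D[]].
exists (A1 `|` A2); split.
- exact: salgebra_setU.
- by rewrite subUset; split=> w; [case/A1D|case/A2D].
- rewrite fine_probabilityU//; [|exact: Gm..].
  rewrite A12 A22 -mulrDl -fine_probabilityU ?setUIDK//.
  + by apply: Gm; apply: salgebra_setI.
  + by apply: Gm; apply: salgebra_setD.
  + by apply/seteqP; split => // w [[_ ?] [_]].
move=> i; rewrite ltnS leq_eqVlt => /orP[/eqP ->|iN].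
  by rewrite setIUl A1B A2B setU0.
rewrite setIUl fine_probabilityU//; last 3 first.
- by apply: Gm; apply: salgebra_setI.
- by apply: Gm; apply: salgebra_setI.
- by rewrite setIACA A12I set0I.
rewrite A1i// A2i// -mulrDl -fine_probabilityU.
- by rewrite -setIUl setUIDK.
- by apply/Gm/(salgebra_setI sG) => //; exact: salgebra_setI.
- by apply/Gm/(salgebra_setI sG) => //; exact: salgebra_setD.
- by apply/seteqP; split => // w [[[_ ?] _] [[_]]].
Qed.

(** Each new event halves the whole space and all earlier events at once, so it meets each of them
    in probability 1/4. *)
Lemma atomless_independent_halves N : exists A : nat -> set Om,
  [/\ forall i, G (A i), forall i, (i < N)%N -> pr (A i) = 2^-1 &
      forall i j, (i < j < N)%N -> pr (A i `&` A j) = 4^-1].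
Proof.
elim: N => [|N [A [GA A2 A4]]].
  by exists (fun=> set0); split=> // [i|i j]; [exact: salgebra_set0|rewrite ltn0 andbF].
have [B [GB _ BD Bi]] := atomless_halve_seq N GA (salgebra_setT sG).
exists (fun i => if (i < N)%N then A i else B); split=> [i|i|i j].
- by case: ifP.
- case: ifPn => [iN _|_ _]; first exact: A2.
  by rewrite BD probability_setT/= mul1r.
rewrite ltnS => /andP[ij jN]; have iN : (i < N)%N by exact: leq_trans ij jN.
rewrite iN; case: ifPn => [jN'|_]; first by apply: A4; rewrite ij.
rewrite setIC Bi// setTI A2//; lra.
Qed.

End real_probability.

(** * Integrals of real-valued functions *)

Section real_integral.
Context {d : measure_display} {Om : measurableType d} {R : realType}.
Implicit Types (mu : {measure set Om -> \bar R}) (P Q : probability Om R).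

Lemma integrable_measurable_fun mu (f : Om -> R) :
  mu.-integrable setT (EFin \o f) -> measurable_fun setT f.
Proof. by move=> /measurable_int/measurable_EFinP. Qed.

Lemma integrable_le_norm mu (f g : Om -> R) : measurable_fun setT f ->
  mu.-integrable setT (EFin \o g) -> (forall w, `|f w| <= g w) ->
  mu.-integrable setT (EFin \o f).
Proof.
move=> mf ig fg; apply: le_integrable ig => //; first exact/measurable_EFinP.
move=> w _ /=; rewrite lee_fin (le_trans (fg w))// ler_norm//.
Qed.

Lemma integrable_bounded P (f : Om -> R) (M : R) : measurable_fun setT f ->
  (forall w, `|f w| <= M) -> P.-integrable setT (EFin \o f).
Proof.
move=> mf fM; apply: (@integrable_le_norm P f (cst M)) => //.
exact: (finite_measure_integrable_cst P M).
Qed.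

Lemma integrable_scale mu (f : Om -> R) (c : R) :
  mu.-integrable setT (EFin \o f) -> mu.-integrable setT (EFin \o (fun w => c * f w)).
Proof. exact: (integrableZl measurableT c). Qed.

Lemma integrable_add mu (f g : Om -> R) : mu.-integrable setT (EFin \o f) ->
  mu.-integrable setT (EFin \o g) -> mu.-integrable setT (EFin \o (fun w => f w + g w)).
Proof. exact: (integrableD measurableT). Qed.

Lemma integrable_sub mu (f g : Om -> R) : mu.-integrable setT (EFin \o f) ->
  mu.-integrable setT (EFin \o g) -> mu.-integrable setT (EFin \o (fun w => f w - g w)).
Proof. exact: (integrableB measurableT). Qed.

Lemma integrable_mul_bounded mu (f g : Om -> R) (M : R) :
  mu.-integrable setT (EFin \o f) -> measurable_fun setT g ->
  (forall w, `|g w| <= M) -> mu.-integrable setT (EFin \o (fun w => f w * g w)).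
Proof.
move=> intf mg gM; have mf := integrable_measurable_fun intf.
have iM : mu.-integrable setT (EFin \o (fun w => M * `|f w|)).
  by apply: (integrableZl measurableT M (integrable_norm intf)).
apply: integrable_le_norm iM _; first exact: measurable_funM.
by move=> w; rewrite normrM mulrC ler_wpM2r.
Qed.

Lemma measurable_set_le (f g : Om -> R) : measurable_fun setT f ->
  measurable_fun setT g -> measurable [set w | f w <= g w].
Proof.
move=> mf mg; rewrite -[X in measurable X]setTI.
exact: (measurable_fun_ler mf mg measurableT (Y := [set true])).
Qed.

Lemma measurable_set_lt (f g : Om -> R) : measurable_fun setT f ->
  measurable_fun setT g -> measurable [set w | f w < g w].
Proof.
move=> mf mg; rewrite -[X in measurable X]setTI.
exact: (measurable_fun_ltr mf mg measurableT (Y := [set true])).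
Qed.

Lemma Rintegral_probability_cst P (c : R) : \int[P]_w c = c.
Proof. by rewrite /Rintegral integral_cst//= probability_setT mule1. Qed.

Lemma EFin_Rintegral mu (f : Om -> R) : mu.-integrable setT (EFin \o f) ->
  (\int[mu]_w f w)%:E = (\int[mu]_w (f w)%:E)%E.
Proof. by move=> intf; rewrite /Rintegral fineK// integrable_fin_num. Qed.

Lemma Rintegral_dominated_cvg mu (f_ : nat -> Om -> R) (f g : Om -> R) :
  (forall n, measurable_fun setT (f_ n)) -> measurable_fun setT f ->
  mu.-integrable setT (EFin \o g) ->
  {ae mu, forall w, (f_ ^~ w) @ \oo --> f w} ->
  {ae mu, forall w n, `|f_ n w| <= g w} ->
  (fun n => \int[mu]_w `|f_ n w - f w|) @ \oo --> (0 : R).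
Proof.
move=> mf_ mf ig cf gf.
have [||||ifw + _] := @dominated_convergence _ _ _ mu setT measurableT
  (fun n w => (f_ n w)%:E) (EFin \o f) (EFin \o g) _ _ _ ig.
- by move=> n; apply/measurable_EFinP.
- exact/measurable_EFinP.
- by apply: filterS cf => w + _; apply: cvg_EFin; exact: nearW.
- by apply: filterS gf => w + n _ => /(_ n); rewrite lee_fin.
by move=> /fine_cvg.
Qed.

Lemma normB_Rintegral_le mu (f g : Om -> R) :
  mu.-integrable setT (EFin \o f) -> mu.-integrable setT (EFin \o g) ->
  `|\int[mu]_w f w - \int[mu]_w g w| <= \int[mu]_w `|f w - g w|.
Proof.
move=> intf ig; rewrite -RintegralB//; apply: le_normr_Rintegral => //.
exact: (integrableB measurableT intf ig).
Qed.

(** The truncations of [h] to the sets where [|h| <= n] converge to [h] pointwise and are dominated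
    by [|h|], hence converge in [L^1]. *)
Lemma integrable_approx_bounded P (h : Om -> R) (e : R) : 0 < e ->
  P.-integrable setT (EFin \o h) ->
  exists (g : Om -> R) (M : R), [/\ measurable_fun setT g,
    (forall w, `|g w| <= M) & \int[P]_w `|h w - g w| <= e].
Proof.
move=> e0 ih; have mh := integrable_measurable_fun ih.
pose g (n : nat) w : R := h w * \1_[set w | `|h w| <= n%:R] w.
have mA n : measurable [set w | `|h w| <= n%:R].
  by apply: measurable_set_le => //; exact: measurableT_comp.
have mg n : measurable_fun setT (g n).
  by apply: measurable_funM => //; exact: measurable_indic.
have : (fun n => \int[P]_w `|g n w - h w|) @ \oo --> (0 : R).
  apply: (Rintegral_dominated_cvg mg mh (integrable_norm ih)); apply: aeW => w.
    apply: cvg_near_cst.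
    exists (Num.truncn `|h w|).+1 => // n /= hn.
    rewrite /g indicE mem_set ?mulr1//=.
    by apply: ltW; apply: (lt_le_trans (truncnS_gt _)); rewrite ler_nat.
  move=> n; rewrite /g normrM indicE /=.
  by case: (_ \in _) => /=; rewrite ?normr1 ?normr0 ?mulr1 ?mulr0.
move=> /cvgrPdist_le /(_ _ e0) [N _ /(_ N (leqnn _))] /= hN.
exists (g N), N%:R; split=> //.
  move=> w; rewrite /g indicE; have [|_] := boolP (w \in _); rewrite ?mulr1 ?mulr0 ?normr0//.
  by rewrite inE.
under eq_Rintegral do rewrite distrC.
by move: hN; rewrite sub0r normrN; apply: le_trans; exact: ler_norm.
Qed.

End real_integral.

(** * Events nearly uncorrelated with finitely many variables *)

Section mixing_set.
Context {d : measure_display} {Om : measurableType d} {R : realType}.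
Variable P : probability Om R.
Local Notation E f := (Rintegral P setT f).

(** Unlike the indicator, this function is centred when [A] has probability 1/2, and it always has
    norm 1 in [L^2(P)]. *)
Definition sign_of (A : set Om) (w : Om) : R := \1_A w - \1_(~` A) w.

Lemma sign_ofE A w : sign_of A w = if w \in A then 1 else -1.
Proof.
rewrite /sign_of !indicE; have [wA|wA] := boolP (w \in A).
  by rewrite memNset ?subr0//= => /(_ (set_mem wA)).
by rewrite mem_set ?sub0r//= => Aw; rewrite mem_set in wA.
Qed.

Lemma sign_of_sqr A w : sign_of A w * sign_of A w = 1.
Proof. by rewrite sign_ofE; case: ifP => _; rewrite ?mulr1// mulrNN mulr1. Qed.

Lemma norm_sign_of A w : `|sign_of A w| = 1.
Proof. by rewrite sign_ofE; case: ifP => _; rewrite ?normrN normr1. Qed.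

Lemma measurable_sign_of A : measurable A -> measurable_fun setT (sign_of A).
Proof.
move=> mA; apply: measurable_funB; apply: measurable_indic => //.
exact: measurableC.
Qed.

Definition bounded_mfun (f : Om -> R) :=
  measurable_fun setT f /\ exists M : R, forall w, `|f w| <= M.

Lemma bounded_mfunD f g : bounded_mfun f -> bounded_mfun g ->
  bounded_mfun (fun w => f w + g w).
Proof.
move=> [mf [M fM]] [mg [N gN]]; split; first exact: measurable_funD.
by exists (M + N) => w; rewrite (le_trans (ler_normD _ _))// lerD.
Qed.

Lemma bounded_mfunM f g : bounded_mfun f -> bounded_mfun g ->
  bounded_mfun (fun w => f w * g w).
Proof.
move=> [mf [M fM]] [mg [N gN]]; split; first exact: measurable_funM.
by exists (M * N) => w; rewrite normrM ler_pM.
Qed.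

Lemma bounded_mfun_cst c : bounded_mfun (fun=> c).
Proof. by split=> //; exists `|c|. Qed.

Lemma bounded_mfun_sign A : measurable A -> bounded_mfun (sign_of A).
Proof.
move=> mA; split; first exact: measurable_sign_of.
by exists 1 => w; rewrite norm_sign_of.
Qed.

Lemma bounded_mfun_integrable f : bounded_mfun f -> P.-integrable setT (EFin \o f).
Proof. by move=> [mf [M fM]]; exact: integrable_bounded fM. Qed.

Lemma expectation_boundedD f g : bounded_mfun f -> bounded_mfun g ->
  E (fun w => f w + g w) = E f + E g.
Proof. by move=> bf bg; rewrite RintegralD//; exact: bounded_mfun_integrable. Qed.

Lemma expectation_boundedZ c f : bounded_mfun f -> E (fun w => c * f w) = c * E f.
Proof. by move=> bf; rewrite RintegralZl//; exact: bounded_mfun_integrable. Qed.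

Lemma expectation_indic A : measurable A -> E (\1_A : Om -> R) = fine (P A).
Proof. by move=> mA; rewrite /Rintegral integral_indic// setIT. Qed.

(* The sign functions of pairwise independent events of probability 1/2 are
   orthonormal; induction on the number of projections removed from [f]. *)
Lemma bessel_signs (N : nat) (A : nat -> set Om) (f : Om -> R) :
  (forall i, measurable (A i)) ->
  (forall i, (i < N)%N -> fine (P (A i)) = 2^-1) ->
  (forall i j, (i < j < N)%N -> fine (P (A i `&` A j)) = 4^-1) ->
  bounded_mfun f ->
  \sum_(i < N) (E (fun w => f w * sign_of (A i) w)) ^+ 2 <= E (fun w => f w * f w).
Proof.
move=> mA A2 A4 bf; pose r i := sign_of (A i).
have br i : bounded_mfun (r i) by exact: bounded_mfun_sign.
pose c i := E (fun w => f w * r i w).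
have ort i j : (i < j < N)%N -> E (fun w => r i w * r j w) = 0.
  move=> /[dup] ijN /andP[ij jN].
  have bi (B : set Om) : measurable B -> bounded_mfun (\1_B : Om -> R).
    move=> mB; split; first exact: measurable_indic.
    by exists 1 => w; rewrite indicE; case: (_ \in _); rewrite ?normr1 ?normr0.
  have mij : measurable (A i `&` A j) by exact: measurableI.
  (* Expanding the product of [2 1_{A_i} - 1] and [2 1_{A_j} - 1] reduces its mean to
     [4 / 4 - 2 / 2 - 2 / 2 + 1 = 0]. *)
  have -> : E (fun w => r i w * r j w) =
     E (fun w => (4 * \1_(A i `&` A j) w + (- 2 * \1_(A i) w + - 2 * \1_(A j) w)) + 1).
    congr (fine _); apply: eq_integral => w _; congr EFin.
    rewrite /r !sign_ofE !indicE in_setI.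
    by case: (w \in A i); case: (w \in A j) => /=; lra.
  have bZ (k : R) (B : set Om) : measurable B -> bounded_mfun (fun w => k * \1_B w).
    by move=> mB; apply: bounded_mfunM; [exact: bounded_mfun_cst|exact: bi].
  rewrite expectation_boundedD; last exact: bounded_mfun_cst; last first.
    by do 2?[apply: bounded_mfunD; first exact: bZ]; exact: bZ.
  rewrite expectation_boundedD; [|exact: bZ|apply: bounded_mfunD; exact: bZ].
  rewrite expectation_boundedD; [|exact: bZ|exact: bZ].
  rewrite !expectation_boundedZ; [|exact: bi..].
  rewrite !expectation_indic// A4// A2 ?(ltn_trans ij jN)// A2//.
  rewrite Rintegral_probability_cst; lra.
(* [h] is the residual of [f] after all projections are removed; its second moment is
   nonnegative. *)
suff [h [bh hh _]] : exists h, [/\ bounded_mfun h,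
    E (fun w => h w * h w) = E (fun w => f w * f w) - \sum_(i < N) c i ^+ 2 &
    forall m, (N <= m < N)%N -> E (fun w => h w * r m w) = c m].
  rewrite -subr_ge0 -/(c _) -hh; apply: Rintegral_ge0 => w _.
  by rewrite -expr2 sqr_ge0.
(* The last clause records that, by orthogonality, the coefficients of the signs still to be removed
   are unchanged. *)
suff H n : (n <= N)%N -> exists h, [/\ bounded_mfun h,
    E (fun w => h w * h w) = E (fun w => f w * f w) - \sum_(i < n) c i ^+ 2 &
    forall m, (n <= m < N)%N -> E (fun w => h w * r m w) = c m] by exact: H.
elim: n => [_|n IH nN].
  by exists f; split=> //; rewrite big_ord0 subr0.
have [h [bh hh hr]] := IH (ltnW nN).
exists (fun w => h w + - c n * r n w).
have bcr : bounded_mfun (fun w => - c n * r n w).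
  by apply: bounded_mfunM => //; exact: bounded_mfun_cst.
have hn : E (fun w => h w * r n w) = c n by rewrite hr// leqnn.
split=> [||m /andP[nm mN]]; first exact: bounded_mfunD.
- have -> : E (fun w => (h w + - c n * r n w) * (h w + - c n * r n w)) =
     E (fun w => (h w * h w + (- 2 * c n) * (h w * r n w)) + c n ^+ 2).
    congr (fine _); apply: eq_integral => w _; congr EFin.
    have := sign_of_sqr (A n) w; rewrite -/(r n w) => rr.
    transitivity (h w * h w + -2 * c n * (h w * r n w) + c n ^+ 2 * (r n w * r n w)).
      by ring.
    by rewrite rr mulr1.
  have bhr : bounded_mfun (fun w => h w * r n w) by exact: bounded_mfunM.
  rewrite expectation_boundedD; last 2 first.
  + apply: bounded_mfunD; first exact: bounded_mfunM.
    by apply: bounded_mfunM => //; exact: bounded_mfun_cst.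
  + exact: bounded_mfun_cst.
  rewrite expectation_boundedD; last 2 first.
  + exact: bounded_mfunM.
  + by apply: bounded_mfunM => //; exact: bounded_mfun_cst.
  rewrite expectation_boundedZ// hn hh Rintegral_probability_cst big_ord_recr/=.
  by move: (\sum_(i < n) _) => q; ring.
have -> : E (fun w => (h w + - c n * r n w) * r m w) =
   E (fun w => h w * r m w + (- c n) * (r n w * r m w)).
  by congr (fine _); apply: eq_integral => w _; congr EFin; ring.
have brr : bounded_mfun (fun w => r n w * r m w) by exact: bounded_mfunM.
rewrite expectation_boundedD; [|exact: bounded_mfunM|].
  by rewrite expectation_boundedZ// ort ?nm// mulr0 addr0 hr// (ltnW nm).
by apply: bounded_mfunM => //; exact: bounded_mfun_cst.
Qed.

Variable G : set (set Om).
Hypothesis sG : sigma_algebra setT G.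
Hypothesis Gm : G `<=` measurable.
Hypothesis atomG : atomless_on P G.

(** Counting: if each of [N] orthonormal signs had correlation above [e] with some [h k], the Bessel
    inequalities summed over [k] would give [N * e ^+ 2 <= C], which fails for large [N]. *)
Lemma mixing_bounded n (h : 'I_n -> Om -> R) (e : R) : 0 < e ->
  (forall k, bounded_mfun (h k)) ->
  exists2 A, G A & forall k, `|E (fun w => h k w * sign_of A w)| <= e.
Proof.
move=> e0 bh; pose C := \sum_k E (fun w => h k w * h k w).
pose N := (Num.truncn (C / e ^+ 2)).+1.
have CN : C < N%:R * e ^+ 2.
  by rewrite -ltr_pdivrMr ?exprn_gt0//; exact: truncnS_gt.
have [A [GA A2 A4]] := atomless_independent_halves sG Gm atomG N.
apply: contrapT => nA; move: CN; rewrite ltNge => /negP; apply.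
apply: (@le_trans _ _ (\sum_k \sum_(i < N) (E (fun w => h k w * sign_of (A i) w)) ^+ 2)).
  rewrite exchange_big/= -[N in N%:R]card_ord mulr_natl -sumr_const.
  apply: ler_sum => i _; have [k ke] : exists k, e < `|E (fun w => h k w * sign_of (A i) w)|.
    apply: contrapT => nk; apply: nA; exists (A i) => // k.
    by rewrite leNgt; apply/negP => ?; apply: nk; exists k.
  rewrite (bigD1 k)//= -[leLHS]addr0 lerD//; last first.
    by apply: sumr_ge0 => *; exact: sqr_ge0.
  by rewrite -[leRHS]real_normK ?num_real// ler_sqr ?nnegrE ?(ltW e0)// ltW.
by apply: ler_sum => k _; apply: bessel_signs => // i; exact: Gm.
Qed.

(** Bounded variables within [e / 2] in [L^1] replace the [h k]. As signs have absolute value 1,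
    this changes each correlation by at most [e / 2]. *)
Lemma mixing_integrable n (h : 'I_n -> Om -> R) (e : R) : 0 < e ->
  (forall k, P.-integrable setT (EFin \o h k)) ->
  exists2 A, G A & forall k, `|E (fun w => h k w * sign_of A w)| <= e.
Proof.
move=> e0 ih; have e2 : 0 < e / 2 by rewrite divr_gt0.
have [g gP] : exists g : 'I_n -> Om -> R, forall k, bounded_mfun (g k) /\
    E (fun w => `|h k w - g k w|) <= e / 2.
  suff : forall k, exists g : Om -> R, bounded_mfun g /\ E (fun w => `|h k w - g w|) <= e / 2.
    by move=> /choice[g gP]; exists g.
  move=> k; have [g [M [mg gM gE]]] := integrable_approx_bounded e2 (ih k).
  by exists g; split=> //; split=> //; exists M.
have [A GA Ag] := mixing_bounded e2 (fun k => (gP k).1).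
exists A => // k; have [bg gE] := gP k.
have ms := measurable_sign_of (Gm GA).
have i1 : P.-integrable setT (EFin \o (fun w => h k w * sign_of A w)).
  by apply: (integrable_mul_bounded (M := 1)) => // w; rewrite norm_sign_of.
have i2 : P.-integrable setT (EFin \o (fun w => g k w * sign_of A w)).
  by apply/bounded_mfun_integrable/bounded_mfunM => //; exact/bounded_mfun_sign/Gm.
have -> : E (fun w => h k w * sign_of A w) =
   (E (fun w => h k w * sign_of A w) - E (fun w => g k w * sign_of A w)) +
   E (fun w => g k w * sign_of A w) by rewrite subrK.
apply: (le_trans (ler_normD _ _)).
rewrite [leRHS](_ : e = e / 2 + e / 2); last by lra.
apply: lerD => //; apply: le_trans gE; apply: (le_trans (normB_Rintegral_le i1 i2)).
rewrite le_eqVlt; apply/orP; left; apply/eqP; congr (fine _).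
by apply: eq_integral => w _; rewrite -mulrBl normrM norm_sign_of mulr1.
Qed.

End mixing_set.

(** * Densities *)

Section density.
Context {d : measure_display} {Om : measurableType d} {R : realType}.
Variables (P : probability Om R).
Implicit Types (Q : probability Om R) (X f : Om -> R).

Lemma density_abs_cont Q f : is_density P Q f -> abs_cont Q P.
Proof.
move=> [mf f0 Qf] A mA PA; rewrite Qf//; apply: null_set_integral => //.
exact/measurable_funTS/measurable_EFinP.
Qed.

Lemma abs_cont_null_dominates Q : abs_cont Q P -> Q `<< P.
Proof. by move=> QP N N0 A mA AN; apply: QP => //; exact: N0. Qed.

(** The density [f] agrees [P]-almost everywhere with the Radon-Nikodym derivative, since both have
    the same integral over every measurable set. For the derivative the change of variables is
    known. *)
Lemma ge0_integral_density Q f X : is_density P Q f -> measurable_fun setT X ->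
  (forall w, 0 <= X w) ->
  (\int[Q]_w (X w)%:E = \int[P]_w (X w * f w)%:E)%E.
Proof.
move=> Qf mX X0; have [mf f0 QfE] := Qf.
have QP := abs_cont_null_dominates (density_abs_cont Qf).
have mRN := measurable_int _ (Radon_Nikodym_SigmaFinite.f_integrable QP).
have XE0 w : (0 <= (X w)%:E)%E by rewrite lee_fin.
have mXE : measurable_fun setT (EFin \o X) by exact/measurable_EFinP.
rewrite -(Radon_Nikodym_SigmaFinite.change_of_variables QP XE0 measurableT mXE).
have mfE : measurable_fun setT (EFin \o f) by exact/measurable_EFinP.
have ae : ae_eq P setT (Radon_Nikodym_SigmaFinite.f Q P) (EFin \o f).
  apply: integral_ae_eq => //; first exact: Radon_Nikodym_SigmaFinite.f_integrable.
  move=> A _ mA; rewrite -Radon_Nikodym_SigmaFinite.f_integral//.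
  exact: QfE.
apply: ge0_ae_eq_integral => //.
- exact: emeasurable_funM.
- exact/measurable_EFinP/measurable_funM.
- by move=> w _; rewrite mule_ge0// Radon_Nikodym_SigmaFinite.f_ge0.
- by move=> w _; rewrite lee_fin mulr_ge0.
by apply: filterS ae => w /(_ I) /= -> _; rewrite EFinM.
Qed.

(** Positive and negative parts are treated separately; as [f >= 0], multiplying by [f] keeps them
    apart. *)
Lemma integral_density Q f X : is_density P Q f -> measurable_fun setT X ->
  (\int[Q]_w (X w)%:E = \int[P]_w (X w * f w)%:E)%E.
Proof.
move=> Qf mX; have [_ f0 _] := Qf.
rewrite integralE [RHS]integralE; congr (_ - _)%E.
- transitivity (\int[Q]_w (Num.max (X w) 0)%:E)%E.
    by apply: eq_integral => w _; rewrite funeposE EFin_max.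
  rewrite (ge0_integral_density Qf).
  + apply: eq_integral => w _; rewrite funeposE -EFin_max.
    by rewrite maxr_pMl// mul0r.
  + exact: measurable_maxr.
  + by move=> w; rewrite le_max lexx orbT.
- transitivity (\int[Q]_w (Num.max (- X w) 0)%:E)%E.
    by apply: eq_integral => w _; rewrite funenegE EFin_max.
  rewrite (ge0_integral_density Qf).
  + apply: eq_integral => w _; rewrite funenegE -EFinN -EFin_max.
    by rewrite maxr_pMl// mul0r mulNr.
  + by apply: measurable_maxr => //; exact: measurable_funN.
  + by move=> w; rewrite le_max lexx orbT.
Qed.

Lemma integrable_density Q f X : is_density P Q f ->
  Q.-integrable setT (EFin \o X) ->
  P.-integrable setT (EFin \o (fun w => X w * f w)).
Proof.
move=> Qf iX; have mX := integrable_measurable_fun iX; have [mf f0 _] := Qf.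
move/integrableP : iX => [_ iX]; apply/integrableP; split.
  exact/measurable_EFinP/measurable_funM.
have nE : (\int[Q]_x `|(EFin \o X) x| = \int[Q]_x (`|X x|)%:E)%E.
  exact: eq_integral.
move: iX; rewrite nE (ge0_integral_density Qf)//; last exact: measurableT_comp.
apply: le_lt_trans; rewrite le_eqVlt; apply/orP; left; apply/eqP.
by apply: eq_integral => w _ /=; rewrite normrM (ger0_norm (f0 w)).
Qed.

Lemma Rintegral_density Q f X : is_density P Q f -> measurable_fun setT X ->
  \int[Q]_w X w = \int[P]_w (X w * f w).
Proof. by move=> Qf mX; rewrite /Rintegral (integral_density Qf). Qed.

Lemma density_integrable Q f : is_density P Q f -> P.-integrable setT (EFin \o f).
Proof.
move=> Qf; have := @integrable_density Q f (fun=> 1) Qf.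
move=> /(_ (finite_measure_integrable_cst Q 1 measurableT)).
by congr (P.-integrable _ _); apply/funext => w /=; rewrite mul1r.
Qed.

(** Closeness of densities in [L^1(P)] becomes closeness of expectations, uniformly over all
    variables bounded by [a]. *)
Lemma Rintegral_density_close Q1 Q2 f1 f2 X (a : R) :
  is_density P Q1 f1 -> is_density P Q2 f2 -> measurable_fun setT X ->
  (forall w, `|X w| <= a) ->
  `|\int[Q1]_w X w - \int[Q2]_w X w| <= a * \int[P]_w `|f1 w - f2 w|.
Proof.
move=> d1 d2 mX Xa; rewrite (Rintegral_density d1)// (Rintegral_density d2)//.
have i1 := density_integrable d1; have i2 := density_integrable d2.
have i12 : P.-integrable setT (EFin \o (fun w => `|f1 w - f2 w|)).
  exact: (integrable_norm (integrableB measurableT i1 i2)).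
have iX1 := integrable_density d1 (integrable_bounded Q1 mX Xa).
have iX2 := integrable_density d2 (integrable_bounded Q2 mX Xa).
apply: (le_trans (normB_Rintegral_le iX1 iX2)).
rewrite -RintegralZl//; apply: le_Rintegral => //.
- exact: (integrable_norm (integrableB measurableT iX1 iX2)).
- exact: (integrableZl measurableT a i12).
by move=> w _; rewrite -mulrBr normrM ler_wpM2r.
Qed.

(** * Finite nets of measures *)

Section total_variation_net.
Variables (Qs : set (probability Om R)) (dist : probability Om R -> probability Om R -> R).
Variables (f : probability Om R -> Om -> R) (G : Om -> R).
Hypothesis tb : totally_bounded_on Qs dist.
Hypothesis fd : forall Q, Qs Q -> is_density P Q (f Q).
Hypothesis iG : P.-integrable setT (EFin \o G).
Hypothesis fG : {ae P, forall w,
  (forall eps : R, 0 < eps -> exists2 delta : R, 0 < delta &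
     forall Q1 Q2, Qs Q1 -> Qs Q2 -> dist Q1 Q2 < delta ->
       `|f Q1 w - f Q2 w| < eps) /\
  (forall Q, Qs Q -> `|f Q w| <= G w)}.

(** Otherwise there are pairs at distance below [1 / (n + 1)] whose densities stay [e] apart in
    [L^1]. Their differences tend to 0 almost surely and are dominated by [2 * G], contradicting
    dominated convergence. *)
Lemma density_L1_uniformly_continuous (e : R) : 0 < e ->
  exists2 dl : R, 0 < dl & forall Q1 Q2, Qs Q1 -> Qs Q2 -> dist Q1 Q2 < dl ->
    \int[P]_w `|f Q1 w - f Q2 w| <= e.
Proof.
move=> e0; apply: contrapT => nodl.
have [q qP] : exists q : nat -> probability Om R * probability Om R, forall n,
    [/\ Qs (q n).1, Qs (q n).2, dist (q n).1 (q n).2 < n.+1%:R^-1 &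
     e < \int[P]_w `|f (q n).1 w - f (q n).2 w|].
  suff : forall n : nat, exists q : probability Om R * probability Om R,
      [/\ Qs q.1, Qs q.2, dist q.1 q.2 < n.+1%:R^-1 &
       e < \int[P]_w `|f q.1 w - f q.2 w|].
    by move=> /choice[q qP]; exists q.
  move=> n; apply: contrapT => nq; apply: nodl; exists n.+1%:R^-1.
    by rewrite invr_gt0.
  move=> Q1 Q2 Q1s Q2s d12; rewrite leNgt; apply/negP => ?.
  by apply: nq; exists (Q1, Q2).
pose h n w : R := f (q n).1 w - f (q n).2 w.
have mh n : measurable_fun setT (h n).
  by have [q1 q2 _ _] := qP n; apply: measurable_funB; have [] := fd q1; have [] := fd q2.
have i2G : P.-integrable setT (EFin \o (fun w => 2 * G w)).
  exact: (integrableZl measurableT 2 iG).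
have : (fun n => \int[P]_w `|h n w - 0|) @ \oo --> (0 : R).
  apply: (@Rintegral_dominated_cvg _ _ _ P h (fun=> 0) (fun w => 2 * G w)) => //.
    apply: filterS fG => w [uc _]; apply/cvgrPdist_lt => eps eps0.
    have [dl dl0 dlP] := uc _ eps0.
    have : (fun n => n.+1%:R^-1) @ \oo --> (0 : R) by exact: cvg_harmonic.
    move=> /cvgrPdist_lt/(_ _ dl0); apply: filterS => n.
    rewrite sub0r normrN ger0_norm ?invr_ge0// => ndl.
    rewrite sub0r normrN; have [q1 q2 q12 _] := qP n.
    by apply: dlP => //; exact: lt_trans ndl.
  apply: filterS fG => w [_ GE] n; have [q1 q2 _ _] := qP n.
  rewrite /h (le_trans (ler_normB _ _))//.
  by have := GE _ q1; have := GE _ q2; lra.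
move=> /cvgrPdist_lt/(_ _ e0)[N _ /(_ N (leqnn _))] /=.
have -> : \int[P]_w `|h N w - 0| = \int[P]_w `|f (q N).1 w - f (q N).2 w|.
  by apply: eq_Rintegral => w _; rewrite subr0.
rewrite sub0r normrN ltNge => /negP; apply.
by have [_ _ _ /ltW/le_trans] := qP N; apply; exact: ler_norm.
Qed.

Lemma density_L1_net (e : R) : 0 < e ->
  exists (n : nat) (q : 'I_n -> probability Om R), (forall i, Qs (q i)) /\
    forall Q, Qs Q -> exists i, \int[P]_w `|f Q w - f (q i) w| <= e.
Proof.
move=> e0; have [dl dl0 dlP] := density_L1_uniformly_continuous e0.
have [s [sQ sdl]] := tb dl0.
exists (size s), (tnth (in_tuple s)); split=> [i|Q QsQ]; first exact/sQ/mem_tnth.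
have [Q' Q's QQ'] := sdl _ QsQ.
have /tnthP[i Q'E] : Q' \in in_tuple s by [].
by exists i; rewrite -Q'E; apply: dlP => //; exact: sQ.
Qed.

(* The tails of the dominated variables are uniformly small, and their
   truncations are controlled by the total variation distance. *)
Lemma uniformly_integrable_net (S : Om -> R) (e : R) :
  measurable_fun setT S ->
  (forall Q, Qs Q -> Q.-integrable setT (EFin \o S)) ->
  (fun a : R => ereal_sup
     [set 'E_Q[(fun w => S w * (\1_[set w' | a < S w'] w))%R]%E
        | Q in Qs]) @ +oo --> 0%E ->
  0 < e ->
  exists (n : nat) (q : 'I_n -> probability Om R), (forall i, Qs (q i)) /\
    forall Q, Qs Q -> exists i, forall X, measurable_fun setT X ->
      (forall w, `|X w| <= S w) ->
      `|\int[Q]_w X w - \int[q i]_w X w| <= e.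
Proof.
move=> mS iS ui e0; have e4 : 0 < e / 4 by rewrite divr_gt0.
have [a a0 aP] : exists2 a : R, 0 < a & forall Q, Qs Q ->
    \int[Q]_w (S w * \1_[set w' | a < S w'] w) <= e / 4.
  have : \forall a \near +oo, (ereal_sup
     [set 'E_Q[(fun w => S w * (\1_[set w' | a < S w'] w))%R]%E
        | Q in Qs] < (e / 4)%:E)%E.
    apply: (ui (fun u => (u < (e / 4)%:E)%E)).
    by apply: open_ereal_lt'; rewrite lte_fin.
  (* [|b| + 1] lies beyond the threshold [b] and is also positive, as the division by [a] below
     requires. *)
  case=> b [_ /(_ (`|b| + 1))] /= bP.
  have {bP}/bP bP : b < `|b| + 1 by rewrite ltr_pwDr// ler_norm.
  exists (`|b| + 1) => [|Q QsQ]; first by rewrite ltr_pwDr.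
  rewrite -lee_fin EFin_Rintegral; last first.
    apply: (integrable_mul_bounded (M := 1) (iS _ QsQ)).
      by apply: measurable_indic; exact: measurable_set_lt.
    by move=> w; rewrite indicE; case: (_ \in _); rewrite ?normr1 ?normr0.
  apply: le_trans (ltW bP); apply: ereal_sup_ubound; exists Q => //.
  by rewrite unlock.
have ea : 0 < e / 4 / a by rewrite divr_gt0.
have [n [q [qs qP]]] := density_L1_net ea.
exists n, q; split=> // Q QsQ; have [i Qi] := qP _ QsQ; exists i => X mX XS.
have mA : measurable [set w | a < S w] by exact: measurable_set_lt.
(* [Y] lives on the tail of [S] and costs at most [e / 4] under each of the two measures; [Z] is
   bounded by [a] and costs [a] times the net scale, that is [e / 4]. *)
pose Y w := X w * \1_[set w | a < S w] w; pose Z w := X w * \1_(~` [set w | a < S w]) w.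
have iX Q' : Qs Q' -> Q'.-integrable setT (EFin \o X).
  by move=> Q's; apply: integrable_le_norm (iS _ Q's) _.
have ind1 (A : set Om) w : `|\1_A w : R| <= 1.
  by rewrite indicE; case: (_ \in _); rewrite ?normr1 ?normr0.
have iY Q' : Qs Q' -> Q'.-integrable setT (EFin \o Y).
  by move=> Q's; apply: (integrable_mul_bounded (M := 1) (iX _ Q's)) => //; exact: measurable_indic.
have iZ Q' : Qs Q' -> Q'.-integrable setT (EFin \o Z).
  move=> Q's; apply: (integrable_mul_bounded (M := 1) (iX _ Q's)) => //.
  by apply: measurable_indic; exact: measurableC.
have XYZ Q' : Qs Q' -> \int[Q']_w X w = \int[Q']_w Y w + \int[Q']_w Z w.
  move=> Q's; rewrite -RintegralD//; [|exact: iY|exact: iZ].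
  apply: eq_Rintegral => w _; rewrite /Y /Z -mulrDr !indicE in_setC.
  by case: (_ \in _); rewrite ?addr0 ?add0r mulr1.
have YE Q' : Qs Q' -> `|\int[Q']_w Y w| <= e / 4.
  move=> Q's; apply: le_trans (aP _ Q's).
  apply: (le_trans (le_normr_Rintegral measurableT (iY _ Q's))).
  apply: le_Rintegral => //.
  - exact: (integrable_norm (iY _ Q's)).
  - apply: (integrable_mul_bounded (M := 1) (iS _ Q's)) => //; exact: measurable_indic.
  - by move=> w _; rewrite /Y normrM (@ger0_norm _ (\1_ _ _)) ?ler_wpM2r// indicE.
have ZE : `|\int[Q]_w Z w - \int[q i]_w Z w| <= e / 4.
  have Za w : `|Z w| <= a.
    rewrite /Z indicE; have [|_] := boolP (w \in _); last by rewrite mulr0 normr0 ltW.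
    by rewrite inE/= mulr1 => /negP; rewrite -leNgt; apply: le_trans.
  have mZ : measurable_fun setT Z by exact: integrable_measurable_fun (iZ _ QsQ).
  apply: (le_trans (Rintegral_density_close (fd QsQ) (fd (qs i)) mZ Za)).
  by rewrite mulrC -ler_pdivlMr.
rewrite XYZ// XYZ//; have := YE _ QsQ; have := YE _ (qs i); move: ZE.
rewrite !ler_norml => /andP[? ?] /andP[? ?] /andP[? ?]; apply/andP; split; lra.
Qed.

End total_variation_net.
End density.

(** * Processes and stopping times *)

Section discretization.
Variables (R : realType) (Tend : R).
Hypothesis T0 : 0 < Tend.

(** Right endpoints of a uniform partition, as the paths are right-continuous. The cap keeps the
    points inside [[0, Tend]]. *)
Definition grid (n k : nat) : R := Num.min Tend (Tend * k.+1%:R / n.+1%:R).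

Definition grid_index (n : nat) (t : R) := Num.truncn (t / Tend * n.+1%:R).

Lemma grid_in n k : 0 <= grid n k <= Tend.
Proof.
by rewrite /grid le_min ge_min lexx (ltW T0) divr_ge0// mulr_ge0// ltW.
Qed.

Lemma grid_bounds n t : 0 <= t <= Tend ->
  t <= grid n (grid_index n t) <= t + Tend / n.+1%:R.
Proof.
move=> /andP[t0 tT]; have n0 : 0 < n.+1%:R :> R by [].
have x0 : 0 <= t / Tend * n.+1%:R by rewrite mulr_ge0// divr_ge0// ltW.
have := truncn_itv x0; rewrite -/(grid_index n t); set k := grid_index n t.
rewrite -[k.+1]addn1 natrD => /andP[].
have : t * n.+1%:R = Tend * (t / Tend * n.+1%:R).
  by field; rewrite lt0r_neq0.
move: (t / Tend * _) => x e kx xk.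
rewrite /grid le_min tT -[k.+1]addn1 natrD/=; apply/andP; split.
  by rewrite ler_pdivlMr// e ler_pM2l// ltW.
rewrite ge_min; apply/orP; right.
rewrite ler_pdivrMr// mulrDl divfK ?gt_eqF// e.
by rewrite mulrDr mulr1 lerD2r ler_pM2l.
Qed.

Lemma cvg_grid t : 0 <= t <= Tend ->
  (fun n => grid n (grid_index n t)) @ \oo --> t.
Proof.
move=> t0T; have c0 : (fun n => t + Tend / n.+1%:R) @ \oo --> t.
  rewrite -[X in _ --> X]addr0 -(mulr0 Tend).
  by apply: cvgD; [exact: cvg_cst|apply: cvgMr; exact: cvg_harmonic].
apply: (squeeze_cvgr _ (cvg_cst t) c0); apply: nearW => n.
exact: grid_bounds.
Qed.

(** The filter [at_right t] excludes [t] itself, so terms with [s n = t] are handled apart. *)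
Lemma right_continuous_cvg (y : R -> R) (t : R) (s : nat -> R) :
  y @ at_right t --> y t -> (forall n, t <= s n) -> s @ \oo --> t ->
  (fun n => y (s n)) @ \oo --> y t.
Proof.
move=> yt ts st; apply/cvgrPdist_lt => e e0.
have /nbhs_ballP[dl /= dl0 H] : within (fun u => t < u) (nbhs t) (fun u => `|y t - y u| < e).
  by move/cvgrPdist_lt : yt => /(_ _ e0).
move/cvgrPdist_lt : st => /(_ _ dl0); apply: filterS => n sn.
have := ts n; rewrite le_eqVlt => /orP[/eqP <-|tsn]; first by rewrite subrr normr0.
exact: H.
Qed.

Lemma right_continuous_grid (y : R -> R) (t : R) :
  (forall u, 0 <= u < Tend -> y @ at_right u --> y u) -> 0 <= t <= Tend ->
  (fun n => y (grid n (grid_index n t))) @ \oo --> y t.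
Proof.
move=> yr t0T; have gb n := grid_bounds n t0T.
have /andP[t0] := t0T; rewrite le_eqVlt => /orP[/eqP tT|tT].
  (* Right-continuity says nothing at [Tend]; there the cap makes every grid value equal to
     [Tend]. *)
  have gE n : grid n (grid_index n t) = t.
    apply: le_anti; case/andP: (gb n) => -> _; rewrite andbT {2}tT.
    by case/andP: (grid_in n (grid_index n t)).
  under eq_fun do rewrite gE; exact: cvg_cst.
apply: right_continuous_cvg; [by apply: yr; rewrite t0| |exact: cvg_grid].
by move=> n; case/andP: (gb n).
Qed.

End discretization.

(** * Measurability of stopped values and of the path supremum *)

Section process.
Context {d : measure_display} {Om : measurableType d} {R : realType}.
Variables (Tend : R) (Y : R -> Om -> R).
Hypothesis T0 : 0 < Tend.
Hypothesis mY : forall t : R, 0 <= t <= Tend -> measurable_fun setT (Y t).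
Hypothesis rcY : forall w (t : R), 0 <= t < Tend ->
  (fun s => Y s w) @ at_right t --> Y t w.
Hypothesis bY : forall w, exists M : R, forall t : R, 0 <= t <= Tend -> `|Y t w| <= M.

(** The stopped value is the limit of the values at the grid points above [tau]. For fixed [n] these
    involve only countably many times, on each of which [Y] is measurable. *)
Lemma measurable_stopped (tau : Om -> R) : measurable_fun setT tau ->
  (forall w, 0 <= tau w <= Tend) -> measurable_fun setT (stopped Y tau).
Proof.
move=> mtau tauT.
apply: (@measurable_fun_cvg _ _ _ setT
  (fun n w => Y (grid Tend n (grid_index Tend n (tau w))) w)); last first.
  by move=> w _; exact: (right_continuous_grid T0 (y := Y ^~ w) (@rcY w) (tauT w)).
move=> n _ B mB; rewrite setTI.
pose x w := tau w / Tend * n.+1%:R.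
have mx : measurable_fun setT x.
  by apply: measurable_funM => //; apply: measurable_funM.
have x0 w : 0 <= x w.
  by have /andP[? _] := tauT w; rewrite mulr_ge0// divr_ge0// ltW.
rewrite (_ : _ @^-1` B = \bigcup_k ([set w | k%:R <= x w] `&`
   [set w | x w < k.+1%:R] `&` (Y (grid Tend n k) @^-1` B))).
  apply: bigcup_measurable => k _; apply: measurableI; first apply: measurableI.
  - exact: measurable_set_le.
  - exact: measurable_set_lt.
  - by rewrite -[X in measurable X]setTI; apply: mY => //; exact: grid_in.
apply/seteqP; split=> w /=.
  by move=> Bw; exists (grid_index Tend n (tau w)) => //; split=> //;
    have /andP[] := truncn_itv (x0 w).
move=> [k _ [[/= kx xk] Bw]].
suff -> : grid_index Tend n (tau w) = k by [].
by apply: truncn_def; rewrite -/(x w) kx xk.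
Qed.

Lemma Ystar_ge (t : R) w : 0 <= t <= Tend -> `|Y t w| <= Ystar Tend Y w.
Proof.
move=> tT; apply: ub_le_sup; last by exists t => //=; rewrite in_itv.
have [M YM] := bY w; exists M => _ [s /= sT <-].
by apply: YM; move: sT; rewrite in_itv.
Qed.

(** By right-continuity the supremum over [[0, Tend]] equals the supremum over the countably many
    grid points. *)
Lemma measurable_Ystar : measurable_fun setT (Ystar Tend Y).
Proof.
(* [q] enumerates all pairs of naturals; numbers that encode no pair fall back to [(0, 0)], which
   only repeats a grid point. *)
pose q (m : nat) : nat * nat := odflt (0%N, 0%N) (unpickle m).
pose h m w : R := `|Y (grid Tend (q m).1 (q m).2) w|.
have hY m w : h m w <= Ystar Tend Y w by apply: Ystar_ge; exact: grid_in.
have ubh w : has_ubound (range (h ^~ w)).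
  by exists (Ystar Tend Y w) => _ [m _ <-].
have -> : Ystar Tend Y = (fun w => sups (h ^~ w) 0).
  apply/funext => w; apply/eqP; rewrite eq_le; apply/andP; split.
    apply: ge_sup.
      by exists `|Y 0 w|, 0 => //=; rewrite in_itv/= lexx ltW.
    move=> _ [t /= + <-]; rewrite in_itv => tT.
    have c : (fun n => `|Y (grid Tend n (grid_index Tend n t)) w|) @ \oo --> `|Y t w|.
      by apply: cvg_norm; exact: (right_continuous_grid T0 (y := Y ^~ w) (@rcY w) tT).
    rewrite -(cvg_lim _ c)//; apply: limr_le; first by apply/cvg_ex; eexists; exact: c.
    apply: nearW => n; apply: ub_le_sup.
      by have [u uP] := ubh w; exists u => _ [m _ <-]; apply: uP; exists m.
    exists (pickle (n, grid_index Tend n t)) => //=.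
    by rewrite /h /q pickleK.
  apply: ge_sup; first by exists (h 0%N w), 0%N.
  by move=> _ [m _ <-].
apply: measurable_fun_sups => // m; apply: measurableT_comp => //.
by apply: mY; exact: grid_in.
Qed.

End process.

(** * Stopping times and switching between them *)

Section stopping_times.
Context {d : measure_display} {Om : measurableType d} {R : realType}.
Variables (P : probability Om R) (Tend : R) (F : R -> set (set Om)).
Hypothesis T0 : 0 < Tend.
Hypothesis FP : usual_filtration P Tend F.

Lemma filtration_sigma t : 0 <= t <= Tend -> sigma_algebra setT (F t).
Proof. by case: FP => + _ _ _ _; exact. Qed.

Lemma filtration_sub t : 0 <= t <= Tend -> F t `<=` measurable.
Proof. by case: FP => _ + _ _ _; exact. Qed.

Lemma filtration_mono s t : 0 <= s -> s <= t -> t <= Tend -> F s `<=` F t.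
Proof. by case: FP => _ _ + _ _; exact. Qed.

Lemma stopping_time_cst t : 0 <= t <= Tend -> stopping_time Tend F (fun=> t).
Proof.
move=> tT; split=> // s sT; have sF := filtration_sigma sT.
have [ts|st] := leP t s.
  rewrite (_ : mkset _ = setT); first exact: salgebra_setT.
  by apply/seteqP; split=> // w _ /=.
rewrite (_ : mkset _ = set0); first exact: salgebra_set0.
by apply/seteqP; split=> // w /=; rewrite leNgt st.
Qed.

Lemma stopping_time_measurable tau : stopping_time Tend F tau ->
  measurable_fun setT tau.
Proof.
move=> [tauT tauF]; apply: (measurability _ (@RGenOInfty.measurableE R)).
move=> _ [_ [x ->] <-]; rewrite setTI.
rewrite (_ : _ @^-1` _ = ~` [set w | tau w <= x]); last first.
  by apply/seteqP; split=> w /=; rewrite in_itv/= andbT ltNge => /negP.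
apply: measurableC; have [x0|x0] := ltP x 0.
  rewrite (_ : mkset _ = set0)//; apply/seteqP; split=> // w /= h.
  by have /andP[h' _] := tauT w; have := le_lt_trans (le_trans h' h) x0; rewrite ltxx.
have [xT|xT] := leP x Tend.
  by apply: filtration_sub; [exact: (introT andP (conj x0 xT))|exact/tauF/andP].
rewrite (_ : mkset _ = setT)//; apply/seteqP; split=> // w _ /=.
by have /andP[_ h] := tauT w; exact: le_trans (ltW xT).
Qed.

(** The choice between [tau1] and [tau2] is known only at time [t], when [A] is decided; delaying
    both to [t] makes the result a stopping time. *)
Definition switch (A : set Om) (t : R) (tau1 tau2 : Om -> R) (w : Om) : R :=
  if w \in A then Num.max (tau1 w) t else Num.max (tau2 w) t.

Lemma stopping_time_switch A t tau1 tau2 : 0 <= t <= Tend -> F t A ->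
  stopping_time Tend F tau1 -> stopping_time Tend F tau2 ->
  stopping_time Tend F (switch A t tau1 tau2).
Proof.
move=> /[dup] tT /andP[t0 tT'] FA [tau1T tau1F] [tau2T tau2F]; split=> [w|s sT].
  have /andP[a b] := tau1T w; have /andP[a' b'] := tau2T w.
  by rewrite /switch; case: ifP => _; rewrite le_max ge_max ?a ?a' ?b ?b' tT'.
have sF := filtration_sigma sT.
have [ts|st] := leP t s; last first.
  rewrite (_ : mkset _ = set0); first exact: salgebra_set0.
  apply/seteqP; split=> // w /=; rewrite /switch; case: ifP => _;
  by rewrite ge_max [t <= s]leNgt st andbF.
have sA : F s A by apply: (filtration_mono t0 ts) => //; case/andP: sT.
rewrite (_ : mkset _ = (A `&` [set w | tau1 w <= s]) `|` ((~` A) `&` [set w | tau2 w <= s])).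
  apply: (salgebra_setU sF).
  - by apply: (salgebra_setI sF) => //; exact: tau1F.
  - by apply: (salgebra_setI sF); [exact: salgebra_setC|exact: tau2F].
apply/seteqP; split=> w /=; rewrite /switch.
  case: ifPn => [|/negP]; rewrite inE ge_max => ? /andP[? _]; by [left|right].
move=> [[Aw h]|[Aw h]].
  by rewrite mem_set// ge_max h.
by rewrite memNset// ge_max h.
Qed.

End stopping_times.

(** * The minimax equality *)

Section mixture.
Context {d : measure_display} {Om : measurableType d} {R : realType}.
Variable P : probability Om R.

Lemma mnormalize_mass1 (mu : {measure set Om -> \bar R}) A :
  mu setT = 1%E -> mnormalize mu P A = mu A.
Proof. by move=> mu1; rewrite /mnormalize mu1 onee_eq0/= invr1 mule1. Qed.

(** The weighted sum has mass 1, so normalising it changes nothing and only supplies the probability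
    structure; [P] is the fallback that [mnormalize] asks for in the degenerate cases. *)
Lemma mixture_exists n (w : 'I_n -> R) (q : 'I_n -> probability Om R) :
  (forall i, 0 <= w i) -> \sum_i w i = 1 ->
  exists mu : probability Om R,
    forall A, measurable A -> mu A = (\sum_i (w i)%:E * q i A)%E.
Proof.
move=> w0 w1.
(* [msum] is indexed by naturals, so indices beyond [n] receive the zero measure. *)
pose m (k : nat) : {measure set Om -> \bar R} :=
  if insub k is Some i then mscale (NngNum (w0 i)) (q i) : {measure set Om -> \bar R}
  else mzero.
have mE A : msum m n A = (\sum_i (w i)%:E * q i A)%E.
  rewrite /msum; apply: eq_bigr => i _; rewrite /m insubT//= => in_.
  by congr (mscale (NngNum (w0 _)) (q _) A); apply/val_inj.
have m1 : msum m n setT = 1%E.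
  rewrite mE; under eq_bigr do rewrite probability_setT mule1.
  by rewrite sumEFin w1.
exists (mnormalize (msum m n) P) => A mA; rewrite -mE; exact: mnormalize_mass1.
Qed.

Lemma is_density_mixture n (w : 'I_n -> R) (q : 'I_n -> probability Om R)
    (f : 'I_n -> Om -> R) (mu : probability Om R) :
  (forall i, 0 <= w i) -> (forall i, is_density P (q i) (f i)) ->
  (forall A, measurable A -> mu A = (\sum_i (w i)%:E * q i A)%E) ->
  is_density P mu (fun x => \sum_i w i * f i x).
Proof.
move=> w0 qf muE.
have mwf i : measurable_fun setT (fun x => w i * f i x).
  by apply: measurable_funM => //; have [] := qf i.
split.
- exact: measurable_sum.
- by move=> x; apply: sumr_ge0 => i _; rewrite mulr_ge0//; have [] := qf i.
move=> A mA; rewrite muE//.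
under [RHS]eq_integral do rewrite -sumEFin.
rewrite ge0_integral_sum//; last 2 first.
- by move=> i; apply/measurable_EFinP/measurable_funTS.
- by move=> i x _; rewrite lee_fin mulr_ge0//; have [] := qf i.
apply: eq_bigr => i _; have [mf f0 ->//] := qf i.
under [RHS]eq_integral do rewrite EFinM.
rewrite ge0_integralZl_EFin//; first by move=> x _; rewrite lee_fin f0.
exact/measurable_EFinP/measurable_funTS.
Qed.

End mixture.

(** * Minimax for optimal stopping *)

Section robust_stopping.
Context {d : measure_display} {Om : measurableType d} {R : realType}.
Variables (P : probability Om R) (Tend : R) (F : R -> set (set Om)).
Variables (Qs : set (probability Om R)) (Y : R -> Om -> R).
Variables (f : probability Om R -> Om -> R).
Hypothesis T0 : 0 < Tend.
Hypothesis FP : usual_filtration P Tend F.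
Hypothesis fd : forall Q, Qs Q -> is_density P Q (f Q).
Hypothesis adY : forall t : R, 0 <= t <= Tend -> measurable_wrt (F t) (Y t).
Hypothesis rcY : forall w (t : R), 0 <= t < Tend ->
  (fun s => Y s w) @ at_right t --> Y t w.
Hypothesis bY : forall w, exists M : R, forall t : R, 0 <= t <= Tend -> `|Y t w| <= M.
Variable M : R.
Hypothesis YM : forall Q, Qs Q -> ('E_Q[Ystar Tend Y]%E <= M%:E)%E.

Local Notation S := (Ystar Tend Y).

Lemma adapted_measurable (t : R) : 0 <= t <= Tend -> measurable_fun setT (Y t).
Proof.
by move=> tT _ B mB; rewrite setTI; apply: (filtration_sub FP tT); exact: adY.
Qed.

Lemma adapted_measurable_Ystar : measurable_fun setT S.
Proof. exact: measurable_Ystar T0 adapted_measurable rcY bY. Qed.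

Lemma Ystar_ge0 w : 0 <= S w.
Proof.
by apply: le_trans (normr_ge0 (Y 0 w)) (Ystar_ge bY w _); rewrite lexx ltW.
Qed.

Lemma integrable_Ystar Q : Qs Q -> Q.-integrable setT (EFin \o S).
Proof.
move=> QsQ; apply/integrableP; split; first exact/measurable_EFinP/adapted_measurable_Ystar.
have := YM QsQ; rewrite unlock => /le_lt_trans /(_ (ltry _)).
apply: le_lt_trans; rewrite le_eqVlt; apply/orP; left; apply/eqP.
by apply: eq_integral => w _ /=; rewrite ger0_norm// Ystar_ge0.
Qed.

Section stopping_time.
Variable tau : Om -> R.
Hypothesis stau : stopping_time Tend F tau.

Lemma measurable_stoppedY : measurable_fun setT (stopped Y tau).
Proof.
apply: (measurable_stopped T0 adapted_measurable rcY).
  by apply: (stopping_time_measurable FP).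
by case: stau.
Qed.

Lemma stopped_le w : `|stopped Y tau w| <= S w.
Proof. by apply: (Ystar_ge bY); case: stau. Qed.

Lemma integrable_stopped Q : Qs Q -> Q.-integrable setT (EFin \o stopped Y tau).
Proof.
move=> QsQ; apply: integrable_le_norm (integrable_Ystar QsQ) stopped_le.
exact: measurable_stoppedY.
Qed.

Lemma expectation_stopped Q : Qs Q ->
  'E_Q[stopped Y tau]%E = (\int[Q]_w stopped Y tau w)%:E.
Proof. by move=> QsQ; rewrite unlock EFin_Rintegral//; exact: integrable_stopped. Qed.

Lemma stopped_bound Q : Qs Q -> `|\int[Q]_w stopped Y tau w| <= M.
Proof.
move=> QsQ; apply: (le_trans (le_normr_Rintegral measurableT (integrable_stopped QsQ))).
apply: (@le_trans _ _ (\int[Q]_w S w)).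
  apply: le_Rintegral => //; [|exact: integrable_Ystar|by move=> w _; exact: stopped_le].
  exact: (integrable_norm (integrable_stopped QsQ)).
rewrite -lee_fin EFin_Rintegral; last exact: integrable_Ystar.
by have := YM QsQ; rewrite unlock.
Qed.

Lemma expectation_mixture n (w : 'I_n -> R) (q : 'I_n -> probability Om R)
    (mu : probability Om R) :
  (forall i, 0 <= w i) -> (forall i, Qs (q i)) ->
  (forall A, measurable A -> mu A = (\sum_i (w i)%:E * q i A)%E) ->
  'E_mu[stopped Y tau]%E = (\sum_i w i * \int[q i]_x stopped Y tau x)%:E.
Proof.
move=> w0 qs muE; have qd i := fd (qs i).
have mX := measurable_stoppedY.
rewrite unlock (integral_density (is_density_mixture w0 qd muE))//.
under eq_integral do rewrite mulr_sumr -sumEFin.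
have iX i : P.-integrable setT (EFin \o (fun x => stopped Y tau x * (w i * f (q i) x))).
  have := integrableZl measurableT (w i) (integrable_density (qd i) (integrable_stopped (qs i))).
  by congr (P.-integrable _ _); apply/funext => x /=; rewrite mulrCA.
rewrite integral_sum// -sumEFin; apply: eq_bigr => i _.
rewrite -EFin_Rintegral// (Rintegral_density (qd i) mX) -RintegralZl//.
  by congr EFin; apply: eq_Rintegral => x _; rewrite mulrCA.
exact: (integrable_density (qd i) (integrable_stopped (qs i))).
Qed.

End stopping_time.

Hypothesis atomF : forall t, 0 < t <= Tend -> atomless_on P (F t).

(* Switch between [tau1] and [tau2] on an event of [F t], [t] small, which is
   nearly independent of the payoffs; right-continuity makes the delay harmless. *)
Lemma stopping_midpoint n (q : 'I_n -> probability Om R) tau1 tau2 (e : R) :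
  (forall i, Qs (q i)) ->
  stopping_time Tend F tau1 -> stopping_time Tend F tau2 -> 0 < e ->
  exists2 tau, stopping_time Tend F tau & forall i,
    `|\int[q i]_w stopped Y tau w -
      (\int[q i]_w stopped Y tau1 w + \int[q i]_w stopped Y tau2 w) / 2| <= e.
Proof.
move=> qs st1 st2 e0; have e2 : 0 < e / 2 by rewrite divr_gt0.
pose t (n : nat) : R := Tend / n.+1%:R.
have tT m : 0 < t m <= Tend.
  rewrite divr_gt0//= ler_pdivrMr// ler_peMr ?(ltW T0)// ler1n//.
have tT' m : 0 <= t m <= Tend by have /andP[/ltW -> ->] := tT m.
have ct : t @ \oo --> (0 : R).
  by rewrite -(mulr0 Tend); apply: cvgMr; exact: cvg_harmonic.
pose dl (tau : Om -> R) m w : R := Num.max (tau w) (t m).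
have sdl tau m : stopping_time Tend F tau -> stopping_time Tend F (dl tau m).
  move=> st; have FT := salgebra_setT (filtration_sigma FP (tT' m)).
  have := stopping_time_switch FP (tT' m) FT st st.
  by congr (stopping_time _ _ _); apply/funext => w; rewrite /switch in_setT.
(* The delayed payoff converges pointwise by right-continuity and is dominated by [S]; where [tau]
   equals [Tend] the delay has no effect. *)
have cdl tau : stopping_time Tend F tau -> \forall m \near \oo, forall i,
    \int[q i]_w `|stopped Y (dl tau m) w - stopped Y tau w| <= e / 2.
  move=> st; apply: filter_forall => i.
  have : (fun m => \int[q i]_w `|stopped Y (dl tau m) w - stopped Y tau w|) @ \oo --> (0 : R).
    apply: (@Rintegral_dominated_cvg _ _ _ (q i) _ _ S).
    - by move=> m; apply: measurable_stoppedY; exact: sdl.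
    - exact: measurable_stoppedY.
    - exact: integrable_Ystar.
    - apply: aeW => w; rewrite /stopped.
      have [/andP[tau0]] := st.1 w; rewrite le_eqVlt => /orP[/eqP tauT|tauT].
        rewrite (_ : (fun m => _) = fun=> Y (tau w) w); first exact: cvg_cst.
        by apply/funext => m; congr (Y _ w); apply/max_idPl; rewrite tauT; case/andP: (tT m).
      apply: (@right_continuous_cvg R (Y ^~ w) (tau w) (fun m => dl tau m w)).
      + by apply: rcY; rewrite tau0.
      + by move=> m; rewrite le_max lexx.
      + apply/cvgrPdist_lt => eps eps0; move/cvgrPdist_lt : ct => /(_ _ eps0).
        apply: filterS => m; rewrite sub0r normrN => tm.
        rewrite distrC /dl; have [h|h] := leP (tau w) (t m); last by rewrite subrr normr0.
        rewrite ger0_norm ?subr_ge0//; apply: le_lt_trans tm.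
        by rewrite ger0_norm ?(le_trans tau0)// gerBl.
    - by apply: aeW => w m; apply: stopped_le; exact: sdl.
  move=> /cvgrPdist_le/(_ _ e2); apply: filterS => m.
  by rewrite sub0r normrN; apply: le_trans; exact: ler_norm.
have : \forall m \near \oo, (forall i,
    \int[q i]_w `|stopped Y (dl tau1 m) w - stopped Y tau1 w| <= e / 2) /\ (forall i,
    \int[q i]_w `|stopped Y (dl tau2 m) w - stopped Y tau2 w| <= e / 2).
  by apply: filterI; exact: cdl.
case=> m0 _ /(_ m0 (leqnn _)); move: {m0}(m0) => m [c1 c2].
have s1 := sdl _ m st1; have s2 := sdl _ m st2.
(* The switched payoff is the average of the two delayed payoffs plus [Z] times the sign of [A], so
   only the correlation of [Z] with this sign has to be small. *)
pose Z w := 2^-1 * (stopped Y (dl tau1 m) w - stopped Y (dl tau2 m) w).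
have iZ i : (q i).-integrable setT (EFin \o Z).
  by apply/integrable_scale/integrable_sub; exact: integrable_stopped.
have [A FA Amix] := mixing_integrable (filtration_sigma FP (tT' m))
  (filtration_sub FP (tT' m)) (atomF (tT m)) e2
  (fun i => integrable_density (fd (qs i)) (iZ i)).
have mA := filtration_sub FP (tT' m) FA.
have st := stopping_time_switch FP (tT' m) FA st1 st2.
exists (switch A (t m) tau1 tau2) => // i.
have iZs : (q i).-integrable setT (EFin \o (fun w => Z w * sign_of A w)).
  apply: (integrable_mul_bounded (M := 1) (iZ i)); first exact: measurable_sign_of.
  by move=> w; rewrite norm_sign_of.
have E : \int[q i]_w stopped Y (switch A (t m) tau1 tau2) w =
  (\int[q i]_w stopped Y (dl tau1 m) w + \int[q i]_w stopped Y (dl tau2 m) w) / 2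
  + \int[q i]_w (Z w * sign_of A w).
  have i1 := integrable_stopped s1 (qs i); have i2 := integrable_stopped s2 (qs i).
  have i12 := integrable_add i1 i2.
  rewrite mulrC -RintegralD// -RintegralZl// -RintegralD//; last first.
    exact: (integrable_scale 2^-1 i12).
  apply: eq_Rintegral => w _; rewrite /Z sign_ofE /stopped /switch -/(dl tau1 m w) -/(dl tau2 m w).
  by case: ifP => _; lra.
have := Amix i; have mZ := integrable_measurable_fun (iZ i).
have -> : \int[P]_w (Z w * f (q i) w * sign_of A w) = \int[q i]_w (Z w * sign_of A w).
  rewrite (Rintegral_density (fd (qs i))).
    by apply: eq_Rintegral => w _; rewrite mulrAC.
  by apply: measurable_funM => //; exact: measurable_sign_of.
rewrite E; have := c1 i; have := c2 i.
have := normB_Rintegral_le (integrable_stopped s1 (qs i)) (integrable_stopped st1 (qs i)).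
have := normB_Rintegral_le (integrable_stopped s2 (qs i)) (integrable_stopped st2 (qs i)).
move=> h1 h2 h3 h4; move: (le_trans h1 h3) (le_trans h2 h4).
rewrite !ler_norml => /andP[? ?] /andP[? ?] /andP[? ?]; apply/andP; split; lra.
Qed.

Lemma conv_hull_sub : Qs `<=` conv_hull Qs.
Proof.
move=> Q QsQ; exists 1%N, (fun=> 1), (fun=> Q); split=> //.
- by rewrite big_ord1.
- by move=> A mA; rewrite big_ord1 mul1e.
Qed.

(** The expectation is affine in the measure, and a weighted average is at least one of its
    terms. *)
Lemma ereal_inf_conv_hull tau : stopping_time Tend F tau ->
  ereal_inf [set 'E_Q[stopped Y tau]%E | Q in conv_hull Qs] =
  ereal_inf [set 'E_Q[stopped Y tau]%E | Q in Qs].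
Proof.
move=> st; apply/eqP; rewrite eq_le; apply/andP; split.
  by apply: ereal_inf_le_tmp => _ [Q QsQ <-]; exists Q => //; exact: conv_hull_sub.
apply: le_ereal_inf_tmp => _ [mu [n [w [q [w0 w1 qs muE]]]] <-].
rewrite (expectation_mixture st w0 qs muE).
pose v i := \int[q i]_x stopped Y tau x.
have [i vi] : exists i, v i <= \sum_i w i * v i.
  apply: contrapT => nv.
  have h i : \sum_i w i * v i < v i.
    by rewrite ltNge; apply/negP => ?; apply: nv; exists i.
  (* If every [v i] exceeded the average, this vanishing sum of nonnegative terms would force all
     weights to be 0. *)
  have : \sum_i w i * (v i - \sum_i w i * v i) = 0.
    under eq_bigr do rewrite mulrBr; rewrite sumrB -mulr_suml w1 mul1r subrr//.
  move=> /eqP; rewrite psumr_eq0 => [/allP wv|i _]; last first.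
    by rewrite mulr_ge0// subr_ge0 ltW.
  have : \sum_i w i = 0.
    apply: big1 => i _; have := wv i; rewrite mem_index_enum => /(_ isT)/=.
    by rewrite mulf_eq0 subr_eq0 (gt_eqF (h i)) orbF => /eqP.
  by rewrite w1 => /eqP; rewrite oner_eq0.
apply: (@le_trans _ _ (v i)%:E); last by rewrite lee_fin.
rewrite -(expectation_stopped st (qs i)); apply: ereal_inf_lbound.
by exists (q i).
Qed.

Hypothesis Qs0 : exists Q, Qs Q.
Hypothesis net : forall e : R, 0 < e ->
  exists (n : nat) (q : 'I_n -> probability Om R), (forall i, Qs (q i)) /\
    forall Q, Qs Q -> exists i, forall X : Om -> R, measurable_fun setT X ->
      (forall w, `|X w| <= S w) ->
      `|\int[Q]_w X w - \int[q i]_w X w| <= e.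

(** The approximate minimax theorem is applied to the payoff vectors. A weight vector is a mixture
    in the convex hull, for which some stopping time earns more than [c - e / 2]; the other [e / 2]
    is lost in the minimax step. *)
Lemma finite_robust_stopping n (q : 'I_n -> probability Om R) (c e : R) :
  (forall i, Qs (q i)) -> 0 < e ->
  (forall mu, conv_hull Qs mu ->
    (c%:E <= ereal_sup [set 'E_mu[stopped Y tau]%E | tau in stopping_time Tend F])%E) ->
  exists2 tau, stopping_time Tend F tau &
    forall i, c - e <= \int[q i]_w stopped Y tau w.
Proof.
move=> qs e0 cP; have e2 : 0 < e / 2 by rewrite divr_gt0.
pose v (tau : Om -> R) (i : 'I_n) : R := \int[q i]_w stopped Y tau w.
pose K := [set v tau | tau in stopping_time Tend F].
have [|||||_ [tau st <-] tauP] := @approx_minimax R n K _ M (c - e / 2) (e / 2).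
- move=> _ _ r [t1 st1 <-] [t2 st2 <-] r0.
  have [t st tP] := stopping_midpoint qs st1 st2 r0.
  by exists (v t) => //; exists t.
- by exists (v (fun=> 0)), (fun=> 0) => //; apply: (stopping_time_cst FP); rewrite lexx ltW.
- by move=> _ i [t st <-]; exact: stopped_bound.
- move=> w w0 w1; have [mu muE] := mixture_exists P q w0 w1.
  have /cP : conv_hull Qs mu by exists n, w, q.
  move=> cmu; have : ((c - e / 2)%:E <
      ereal_sup [set 'E_mu[stopped Y tau]%E | tau in stopping_time Tend F])%E.
    by apply: lt_le_trans cmu; rewrite lte_fin; lra.
  move=> /ereal_sup_gt[_ [tau st <-]]; rewrite (expectation_mixture st w0 qs muE) lte_fin.
  by move=> /ltW h; exists (v tau) => //; exists tau.
- exact: e2.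
by exists tau => // i; have := tauP i; rewrite /v; lra.
Qed.

Lemma robust_stopping_minimax :
  (ereal_sup [set ereal_inf [set 'E_Q[stopped Y tau]%E | Q in Qs]
                | tau in stopping_time Tend F]
   = ereal_sup [set ereal_inf [set 'E_Q[stopped Y tau]%E | Q in conv_hull Qs]
                | tau in stopping_time Tend F]
   /\
   ereal_sup [set ereal_inf [set 'E_Q[stopped Y tau]%E | Q in conv_hull Qs]
                | tau in stopping_time Tend F]
   = ereal_inf [set ereal_sup [set 'E_Q[stopped Y tau]%E
                                 | tau in stopping_time Tend F]
                | Q in conv_hull Qs]).
Proof.
set A := ereal_sup _; set B := ereal_sup _; set C := ereal_inf _.
have AB : A = B.
  congr ereal_sup; apply/seteqP; split=> _ [tau st <-]; exists tau => //.
    exact: ereal_inf_conv_hull.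
  by rewrite ereal_inf_conv_hull.
have s0 : stopping_time Tend F (fun=> 0).
  by apply: (stopping_time_cst FP); rewrite lexx ltW.
have BC : (B <= C)%E.
  apply: ge_ereal_sup => _ [tau st <-]; apply: le_ereal_inf_tmp => _ [mu cmu <-].
  apply: (@le_trans _ _ ('E_mu[stopped Y tau])%E).
    by apply: ereal_inf_lbound; exists mu.
  by apply: ereal_sup_ubound; exists tau.
split=> //; apply/eqP; rewrite eq_le BC/=.
have [Q0 Q0s] := Qs0.
(* [C] must be finite to serve as the real constant of the finite problem. *)
have Clt : (C <= M%:E)%E.
  apply: ge_ereal_inf.
  exists (ereal_sup [set 'E_Q0[stopped Y tau]%E | tau in stopping_time Tend F]).
    by exists Q0 => //; exact: conv_hull_sub.
  apply: ge_ereal_sup => _ [tau st <-]; rewrite expectation_stopped// lee_fin.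
  exact: le_trans (ler_norm _) (stopped_bound st Q0s).
have Cgt : ((- M)%:E <= C)%E.
  apply: le_trans BC; apply: le_ereal_sup_tmp.
  exists (ereal_inf [set 'E_Q[stopped Y (fun=> 0%R)]%E | Q in conv_hull Qs]).
    by exists (fun=> 0).
  rewrite ereal_inf_conv_hull//; apply: le_ereal_inf_tmp => _ [Q QsQ <-].
  rewrite expectation_stopped// lee_fin.
  by have := stopped_bound s0 QsQ; rewrite ler_norml => /andP[].
have Cfin : C \is a fin_num.
  by rewrite fin_numE -ltNye -ltey (lt_le_trans (ltNyr _) Cgt) (le_lt_trans Clt (ltry _)).
(* Half of [e] pays for passing to the net, the other half for the finite minimax problem. *)
rewrite -AB; apply/lee_addgt0Pr => e e0; have e2 : 0 < e / 2 by rewrite divr_gt0.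
have [n [q [qs qP]]] := net e2.
have [|tau st tauP] := @finite_robust_stopping n q (fine C) (e / 2) qs e2.
  by move=> mu cmu; rewrite fineK//; apply: ereal_inf_lbound; exists mu.
rewrite -leeBlDr// -(fineK Cfin) -EFinB; apply: le_ereal_sup_tmp.
exists (ereal_inf [set 'E_Q[stopped Y tau]%E | Q in Qs]); first by exists tau.
apply: le_ereal_inf_tmp => _ [Q QsQ <-]; rewrite expectation_stopped// lee_fin.
have [i /(_ _ (measurable_stoppedY st) (stopped_le st))] := qP _ QsQ.
by have := tauP i; rewrite ler_norml => ? /andP[? ?]; lra.
Qed.

End robust_stopping.

(** * Conditional probabilities and essential infima *)

Section sub_measure.
Context {d : measure_display} {Om : measurableType d} {R : realType}.
Variable G : set (set Om).

(* The proofs are arguments so that the measure structure can be inferred. *)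
Definition sub_measure (sG : sigma_algebra setT G) (Gm : G `<=` measurable)
  (Q : {finite_measure set Om -> \bar R}) (B : set (g_sigma_algebraType G)) : \bar R :=
  Q (B : set Om).

Hypothesis sG : sigma_algebra setT G.
Hypothesis Gm : G `<=` measurable.
Variable Q : {finite_measure set Om -> \bar R}.
Local Notation mu := (sub_measure sG Gm Q).

Lemma measurable_sub (B : set (g_sigma_algebraType G)) :
  measurable B -> measurable (B : set Om).
Proof. by move=> mB; apply: Gm; rewrite -(measurable_g_measurableTypeE sG). Qed.

Let sub_measure0 : mu set0 = 0%E. Proof. exact: measure0. Qed.

Let sub_measure_ge0 B : (0 <= mu B)%E. Proof. exact: measure_ge0. Qed.

Let sub_measure_sigma_additive : semi_sigma_additive mu.
Proof.
move=> B mB tB mUB; apply: (@measure_semi_sigma_additive _ _ _ Q B) => //.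
  by move=> n; exact: measurable_sub.
exact: measurable_sub.
Qed.

HB.instance Definition _ := isMeasure.Build _ _ _ mu
  sub_measure0 sub_measure_ge0 sub_measure_sigma_additive.

Let sub_measure_fin : fin_num_fun mu.
Proof. by move=> B mB; apply: fin_num_measure; exact: measurable_sub. Qed.

HB.instance Definition _ := Measure_isFinite.Build _ _ _ mu sub_measure_fin.

End sub_measure.

Section sub_sigma_algebra.
Context {d : measure_display} {Om : measurableType d} {R : realType}.
Variable G : set (set Om).
Hypothesis sG : sigma_algebra setT G.
Hypothesis Gm : G `<=` measurable.
Implicit Types (X Y : Om -> R) (Q : probability Om R).
Local Notation OmG := (g_sigma_algebraType G).

(** On [g_sigma_algebraType G] the measurable sets are exactly those of [G], so the stability
    results for measurable functions become available. *)
Lemma measurable_wrtP X : measurable_wrt G X <-> measurable_fun (setT : set OmG) X.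
Proof.
split=> [mX _ B mB|mX B mB].
  by rewrite setTI; apply: sub_sigma_algebra; exact: mX.
have := mX measurableT B mB; rewrite setTI.
by rewrite (measurable_g_measurableTypeE sG).
Qed.

Lemma measurable_wrt_measurable_fun X : measurable_wrt G X -> measurable_fun setT X.
Proof. by move=> mX _ B mB; rewrite setTI; apply: Gm; exact: mX. Qed.

(** The restricted measure is the image of [Q] under the identity, seen as a map to the coarser
    measurable space. *)
Lemma ge0_integral_sub_measure Q (h : OmG -> \bar R) (B : set Om) : G B ->
  measurable_fun setT h -> (forall w, (0 <= h w)%E) ->
  (\int[sub_measure sG Gm Q]_(w in B) h w = \int[Q]_(w in B) h w)%E.
Proof.
move=> GB mh h0.
have mid : measurable_fun setT (idfun : Om -> OmG).
  by move=> _ C mC; rewrite setTI; exact: (measurable_sub sG Gm).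
have mB : measurable (B : set OmG) by apply: sub_sigma_algebra.
have mhB : measurable_fun (B : set OmG) h by exact: measurable_funTS.
have := ge0_integral_pushforward mid Q mB mhB (fun y _ => h0 y).
move=> <-; exact: eq_measure_integral.
Qed.

(** The Radon-Nikodym derivative on [G] of [Q (A & .)] with respect to [Q], cut at 1 so that the
    bounds hold at every point. *)
Lemma cond_exp_indic_exists Q (A : set Om) : measurable A ->
  exists C : Om -> R, [/\ measurable_wrt G C, (forall w, 0 <= C w <= 1) &
    forall B, G B -> (\int[Q]_(w in B) (C w)%:E = Q (A `&` B))%E].
Proof.
move=> mA; pose mu : {finite_measure set OmG -> \bar R} := sub_measure sG Gm Q.
pose nu : {finite_measure set OmG -> \bar R} := sub_measure sG Gm (mrestr Q mA).
have numu : nu `<< mu.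
  move=> N N0 B mB BN; have mB' := measurable_sub sG Gm mB.
  apply/eqP; rewrite eq_le measure_ge0 andbT -(N0 B mB BN).
  by apply: le_measure; rewrite ?inE//; exact: measurableI.
pose h := Radon_Nikodym_SigmaFinite.f nu mu.
have h0 w : (0 <= h w)%E by exact: Radon_Nikodym_SigmaFinite.f_ge0.
have mh : measurable_fun setT h.
  exact: measurable_int (Radon_Nikodym_SigmaFinite.f_integrable numu).
have hE B : G B -> (\int[Q]_(w in B) h w = Q (A `&` B))%E.
  move=> GB; rewrite -ge0_integral_sub_measure//.
  rewrite -Radon_Nikodym_SigmaFinite.f_integral//; last exact: sub_sigma_algebra.
  by rewrite setIC.
pose C0 w := fine (h w).
have C0E w : (C0 w)%:E = h w by rewrite fineK// Radon_Nikodym_SigmaFinite.f_fin_num.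
have mC0 : measurable_fun (setT : set OmG) C0 by exact: measurableT_comp.
have mC0Q : measurable_fun (setT : set Om) C0.
  by apply/measurable_wrt_measurable_fun/measurable_wrtP.
pose C w := Num.min (C0 w) 1.
have mC : measurable_fun (setT : set OmG) C by exact: measurable_minr.
pose N := [set w | 1 < C0 w].
have GN : G N.
  have /measurable_wrtP mC0' := mC0.
  have := mC0' _ (measurable_itv `]1, +oo[).
  congr G; apply/seteqP; split=> w /=; by rewrite /N /= in_itv/= andbT.
have mN := Gm GN.
(* On [N] the function [C0 - 1] is positive, while its integral is [Q (A & N) - Q N <= 0]; hence the
   cut at 1 only acts on a null set. *)
have QN : Q N = 0%E.
  have i0 : (\int[Q]_(w in N) (C0 w - 1)%:E = 0)%E.
    apply/eqP; rewrite eq_le; apply/andP; split; last first.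
      by apply: integral_ge0 => w /= h1; rewrite lee_fin subr_ge0 ltW.
    have iC0 : Q.-integrable N (EFin \o C0).
      apply/integrableP; split; first exact/measurable_funTS/measurable_EFinP.
      have -> : (\int[Q]_(w in N) `|(EFin \o C0) w| = \int[Q]_(w in N) h w)%E.
        by apply: eq_integral => w _; rewrite /= -C0E ger0_norm// -lee_fin C0E.
      by rewrite hE// -ge0_fin_numE// fin_num_measure//; exact: measurableI.
    rewrite integralB_EFin//; last exact: finite_measure_integrable_cst.
    rewrite integral_cst// mul1e.
    have -> : (\int[Q]_(w in N) (C0 w)%:E = Q (A `&` N))%E.
      by rewrite -hE//; apply: eq_integral => w _; rewrite C0E.
    rewrite sube_le0; apply: le_measure; rewrite ?inE//; exact: measurableI.
  apply/eqP; rewrite eq_le measure_ge0 andbT leNgt; apply/negP => QN0.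
  have : ae_eq Q N (EFin \o (fun w => C0 w - 1)) (cst 0%E).
    apply/ae_eq_integral_abs => //.
      by apply/measurable_funTS/measurable_EFinP; exact: measurable_funB.
    rewrite -[RHS]i0; apply: eq_integral => w /set_mem h1.
    by rewrite /= ger0_norm// subr_ge0 ltW.
  move=> [N' [mN' QN' sub]]; have : (Q N <= Q N')%E.
    apply: le_measure; rewrite ?inE// => w Nw; apply: sub => /= /(_ Nw) [].
    by move=> /eqP; rewrite subr_eq0 => /eqP h1; move: Nw; rewrite /N /= h1 ltxx.
  by rewrite QN' leNgt QN0.
exists C; split.
- exact/measurable_wrtP.
- by move=> w; rewrite /C le_min ge_min lexx orbT ler01 -lee_fin C0E h0.
move=> B GB; rewrite -hE//.
have mB := Gm GB; apply: ge0_ae_eq_integral => //.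
- by apply/measurable_funTS/measurable_EFinP; exact: measurable_minr.
- rewrite (_ : h = EFin \o C0); last by apply/funext => w; rewrite /= C0E.
  exact/measurable_funTS/measurable_EFinP.
- by move=> w _; rewrite lee_fin /C le_min ler01 -lee_fin C0E h0.
exists N; split=> // w /= nw; apply: contrapT => nN; apply: nw => _.
by rewrite -C0E /C min_l// leNgt; apply/negP.
Qed.

(* The infimum along a sequence of indices for which its expectation is minimal. *)
Lemma ess_inf_exists (P : probability Om R) (T : Type) (Ix : set T)
    (Z : T -> Om -> R) (a b : R) : Ix !=set0 ->
  (forall i, Ix i -> measurable_wrt G (Z i)) ->
  (forall i w, Ix i -> a <= Z i w <= b) ->
  exists W, [/\ measurable_wrt G W, (forall w, a <= W w <= b) & ess_inf_of P Ix Z W].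
Proof.
move=> [i0 Ii0] mZ Zab.
have mZ' i : Ix i -> measurable_fun (setT : set OmG) (Z i).
  by move=> Ii; apply/measurable_wrtP; exact: mZ.
pose ok (s : nat -> T) := forall n, Ix (s n).
pose V (s : nat -> T) w := infs (fun n => Z (s n) w) 0.
have lbZ s w : ok s -> has_lbound (range (fun n => Z (s n) w)).
  by move=> oks; exists a => _ [n _ <-]; have /andP[] := Zab _ w (oks n).
have mV s : ok s -> measurable_fun (setT : set OmG) (V s).
  move=> oks; apply: (@measurable_fun_infs _ OmG R setT (fun n w => Z (s n) w) 0).
    by move=> w _; exact: lbZ.
  by move=> n; exact: mZ'.
have infsE s w : V s w = inf [set Z (s n) w | n in setT].
  by congr inf; apply/seteqP; split=> _ [n _ <-]; exists n.
have Vle s n w : ok s -> V s w <= Z (s n) w.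
  by move=> oks; rewrite infsE; apply: ge_inf; [exact: lbZ|exists n].
have Vge s w (c : R) : (forall n, c <= Z (s n) w) -> c <= V s w.
  move=> cZ; rewrite infsE; apply: lb_le_inf; first by exists (Z (s 0%N) w), 0%N.
  by move=> _ [n _ <-].
have Vab s w : ok s -> a <= V s w <= b.
  move=> oks; rewrite Vge/=; last by move=> n; have /andP[] := Zab _ w (oks n).
  by apply: (le_trans (Vle _ 0%N w oks)); have /andP[] := Zab _ w (oks 0%N).
have Vnorm s w : ok s -> `|V s w| <= `|a| + `|b|.
  move=> oks; have /andP[h1 h2] := Vab _ w oks; rewrite ler_norml.
  by have := ler_norm b; have := ler_norm (- a); rewrite normrN;
     have := normr_ge0 a; have := normr_ge0 b; move=> *; apply/andP; split; lra.
have mVQ s : ok s -> measurable_fun (setT : set Om) (V s).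
  by move=> oks; apply/measurable_wrt_measurable_fun/measurable_wrtP; exact: mV.
have iV s : ok s -> P.-integrable setT (EFin \o V s).
  by move=> oks; apply: integrable_bounded (mVQ _ oks) _ => w; exact: Vnorm.
pose J := [set \int[P]_w V s w | s in ok].
have infJ : has_inf J.
  split; first by exists (\int[P]_w V (fun=> i0) w), (fun=> i0).
  exists a => _ [s oks <-]; rewrite -[leLHS](Rintegral_probability_cst P).
  apply: le_Rintegral => //; first exact: (finite_measure_integrable_cst P).
    exact: iV.
  by move=> w _; have /andP[] := Vab _ w oks.
have [s sP] : exists s : nat -> nat -> T, forall k,
    ok (s k) /\ \int[P]_w V (s k) w < inf J + k.+1%:R^-1.
  suff : forall k : nat, exists s, ok s /\ \int[P]_w V s w < inf J + k.+1%:R^-1.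
    by move=> /choice[s sP]; exists s.
  move=> k; have k0 : 0 < k.+1%:R^-1 :> R by rewrite invr_gt0.
  by have [_ [s oks <-] sk] := inf_adherent k0 infJ; exists s.
(* Countably many nearly minimising sequences are merged into one sequence [r], whose infimum lies
   below all of theirs and so has minimal expectation. *)
pose q (m : nat) : nat * nat := odflt (0%N, 0%N) (unpickle m).
pose r m := s (q m).1 (q m).2.
have okr : ok r by move=> m; exact: (sP (q m).1).1.
have VrE k w : V r w <= V (s k) w.
  apply: Vge => n; have := Vle r (pickle (k, n)) w okr.
  by rewrite /r /q pickleK.
exists (V r); split; [by apply/measurable_wrtP => //; exact: mV|by move=> w; exact: Vab|split].
- exact: mVQ.
(* Adding [i] to the sequence cannot lower the minimal expectation, so the infimum stays the same
   almost everywhere and lies below [Z i]. *)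
- move=> i Ii; pose r' n := if n is m.+1 then r m else i.
  have okr' : ok r' by case.
  have r'r w : V r' w <= V r w by apply: Vge => n; exact: (Vle r' n.+1).
  have JE : \int[P]_w (V r w - V r' w) = 0.
    apply/eqP; rewrite eq_le; apply/andP; split; last first.
      by apply: Rintegral_ge0 => w _; rewrite subr_ge0.
    rewrite RintegralB//; [|exact: iV|exact: iV]; rewrite subr_le0.
    apply: (@le_trans _ _ (inf J)); last by apply: ge_inf; [exact: infJ.2|exists r'].
    apply/ler_addgt0Pr => e e0.
    have : (fun n => n.+1%:R^-1) @ \oo --> (0 : R) by exact: cvg_harmonic.
    move=> /cvgrPdist_lt/(_ _ e0)[k _ /(_ k (leqnn _))] /=.
    rewrite sub0r normrN ger0_norm ?invr_ge0// => ke.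
    apply: (@le_trans _ _ (\int[P]_w V (s k) w)).
      apply: le_Rintegral => //; [exact: iV|apply: iV; exact: (sP k).1].
    by apply/ltW/(lt_le_trans (sP k).2); rewrite lerD2l ltW.
  have : ae_eq P setT (EFin \o (fun w => V r w - V r' w)) (cst 0%E).
    apply/ae_eq_integral_abs => //.
      by apply/measurable_EFinP; apply: measurable_funB; exact: mVQ.
    have i12 := integrable_sub (iV _ okr) (iV _ okr').
    transitivity ((\int[P]_w (V r w - V r' w))%:E); last by rewrite JE.
    rewrite EFin_Rintegral//; apply: eq_integral => w _.
    by rewrite /= ger0_norm// subr_ge0.
  apply: filterS => w /(_ I) /= [] /eqP; rewrite subr_eq0 => /eqP ->.
  exact: (Vle r' 0%N).
move=> W' mW' W'Z.
have : {ae P, forall w, forall n, W' w <= Z (r n) w} by apply/ae_foralln => n; exact: W'Z.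
by apply: filterS => w h; exact: Vge.
Qed.

End sub_sigma_algebra.

(** * Time-consistency *)

Section time_consistency.
Context {d : measure_display} {Om : measurableType d} {R : realType}.
Variables (P : probability Om R) (Tend : R) (F : R -> set (set Om)).
Hypothesis T0 : 0 < Tend.
Hypothesis FP : usual_filtration P Tend F.

Lemma stopped_sigma_cst t : 0 <= t <= Tend -> stopped_sigma Tend F (fun=> t) = F t.
Proof.
move=> /[dup] tT /andP[t0 tT']; apply/seteqP; split=> [A [_ /(_ _ tT)]|A FA].
  by rewrite (_ : [set w | t <= t] = setT) ?setIT//; apply/seteqP; split=> // w _ /=.
split; first exact: (filtration_sub FP tT).
move=> s /[dup] sT /andP[s0 sT']; have [ts|st] := leP t s.
  rewrite (_ : [set _ | _] = setT) ?setIT; last by apply/seteqP; split=> // w _ /=.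
  exact: (filtration_mono FP t0 ts).
rewrite (_ : [set _ | _] = set0) ?setI0.
  exact: salgebra_set0 (filtration_sigma FP sT).
by apply/seteqP; split=> // w /=.
Qed.

Lemma Rintegral_indic_setI (Q : probability Om R) (A B : set Om) :
  measurable A -> measurable B -> \int[Q]_(w in B) \1_A w = fine (Q (A `&` B)).
Proof. by move=> mA mB; rewrite /Rintegral integral_indic. Qed.

Lemma Rintegral_sign_of (Q : probability Om R) (g : Om -> R) (B D : set Om) :
  measurable B -> measurable D -> Q.-integrable setT (EFin \o g) ->
  \int[Q]_(w in D) (g w * sign_of B w) =
  \int[Q]_(w in D `&` B) g w - \int[Q]_(w in D `&` ~` B) g w.
Proof.
move=> mB mD ig; rewrite !Rintegral_mkcondr -RintegralB//.
- apply: eq_Rintegral => w _; rewrite sign_ofE !patchE in_setC.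
  by case: (w \in B) => /=; rewrite ?mulr1 ?subr0// mulrN1 sub0r.
- apply: (@integrableS _ _ _ _ setT) => //.
  rewrite -restrict_EFin; apply/(integrable_mkcond (EFin \o g) mB).
  exact: (@integrableS _ _ _ _ setT).
- have mC := measurableC mB; apply: (@integrableS _ _ _ _ setT) => //.
  rewrite -restrict_EFin; apply/(integrable_mkcond (EFin \o g) mC).
  exact: (@integrableS _ _ _ _ setT).
Qed.

Lemma probability01_sets (Q : probability Om R) (A : set Om) : abs_cont Q P ->
  F 0 A -> (Q A = 0%E) \/ (Q (~` A) = 0%E).
Proof.
move=> QP FA; have T00 : 0 <= (0 : R) <= Tend by rewrite lexx ltW.
have mA := filtration_sub FP T00 FA.
have [_ _ _ _ [_ F01 _]] := FP; case: (F01 A FA) => PA; [left|right].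
  exact: QP.
apply: QP; first exact: measurableC.
by rewrite probability_setC// PA subee.
Qed.

(** Every event of [F 0] has probability 0 or 1 under [Q], so the plain expectation is a conditional
    expectation at time 0. *)
Lemma cond_exp_trivial (Q : probability Om R) (X : Om -> R) : abs_cont Q P ->
  Q.-integrable setT (EFin \o X) ->
  cond_exp Q (stopped_sigma Tend F (fun=> 0)) X (fun=> \int[Q]_w X w).
Proof.
move=> QP iX; have T00 : 0 <= (0 : R) <= Tend by rewrite lexx ltW.
rewrite stopped_sigma_cst//; have sF := filtration_sigma FP T00.
have mX := (measurable_EFinP _ _).2 (integrable_measurable_fun iX).
set c := \int[Q]_w X w; split.
- move=> B mB; have [Bc|Bc] := pselect (B c).
    rewrite (_ : _ @^-1` _ = setT); first exact: salgebra_setT.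
    by apply/seteqP; split.
  rewrite (_ : _ @^-1` _ = set0); first exact: salgebra_set0.
  by apply/seteqP; split.
- exact: (finite_measure_integrable_cst Q c).
move=> A FA; have mA := filtration_sub FP T00 FA.
have [QA|QA] := probability01_sets QP FA.
  rewrite !null_set_integral//.
  exact: measurable_funTS.
have eA (h : Om -> R) : Q.-integrable setT (EFin \o h) ->
    (\int[Q]_(w in A) (h w)%:E = \int[Q]_w (h w)%:E)%E.
  move=> ih; rewrite [RHS](@negligible_integral _ _ _ Q setT (~` A))//.
  - by rewrite setTD setCK.
  - exact: measurableC.
have ic : Q.-integrable setT (EFin \o (fun=> c)).
  exact: (finite_measure_integrable_cst Q c).
rewrite (eA _ iX) (eA _ ic) -(EFin_Rintegral iX) -(EFin_Rintegral ic).
by rewrite Rintegral_probability_cst.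
Qed.

(** * Consequences of consistency between time 0 and time [t] *)

Section consistency_identity.
Variable (Qs : set (probability Om R)).
Hypothesis Qeq : forall Q, Qs Q -> equiv_meas Q P.
Hypothesis Qs0 : exists Q, Qs Q.
Hypothesis tc : time_consistent P Tend F Qs.

(** The infimum is approached along a sequence of measures, so only countably many null sets are
    discarded. *)
Lemma ess_inf_of_cst (c : probability Om R -> R) (a : R) :
  (forall Q, Qs Q -> a <= c Q) ->
  ess_inf_of P Qs (fun Q _ => c Q) (fun=> inf [set c Q | Q in Qs]).
Proof.
move=> ac; have infc : has_inf [set c Q | Q in Qs].
  have [Q0 Q0s] := Qs0; split; first by exists (c Q0), Q0.
  by exists a => _ [Q QsQ <-]; exact: ac.
split=> // [Q QsQ|W mW Wc].
  by apply: aeW => w; apply: ge_inf; [exact: infc.2|exists Q].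
have : {ae P, forall w, forall n : nat, W w <= inf [set c Q | Q in Qs] + n.+1%:R^-1}.
  apply/ae_foralln => n; have n0 : 0 < n.+1%:R^-1 :> R by rewrite invr_gt0.
  have [_ [Q QsQ <-] cQ] := inf_adherent n0 infc.
  by apply: filterS (Wc Q QsQ) => w h; exact: le_trans (ltW cQ).
apply: filterS => w Wn; apply/ler_addgt0Pr => e e0.
have : (fun n => n.+1%:R^-1) @ \oo --> (0 : R) by exact: cvg_harmonic.
move=> /cvgrPdist_lt/(_ _ e0)[k _ /(_ k (leqnn _))] /=.
rewrite sub0r normrN ger0_norm ?invr_ge0// => ke.
by apply: le_trans (Wn k) _; rewrite lerD2l ltW.
Qed.

(** Consistency is applied to [X] and to its own conditional essential infimum [Z]. At time [t] both
    have essential infimum [Z], since [Z] is already [F t]-measurable; at time 0 the essential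
    infima are infima of expectations. *)
Lemma time_consistent_expectation (t : R) (X Z : Om -> R)
    (C : probability Om R -> Om -> R) (MX : R) :
  0 <= t <= Tend ->
  measurable_fun setT X -> (forall w, `|X w| <= MX) ->
  measurable_wrt (F t) Z -> (forall w, `|Z w| <= MX) ->
  (forall Q, Qs Q -> cond_exp Q (F t) X (C Q)) ->
  ess_inf_of P Qs C Z ->
  inf [set \int[Q]_w X w | Q in Qs] <= inf [set \int[Q]_w Z w | Q in Qs].
Proof.
move=> tT mX XM mZ ZM CX CZ; have T00 : 0 <= (0 : R) <= Tend by rewrite lexx ltW.
have mZ' : measurable_fun setT Z.
  exact: (measurable_wrt_measurable_fun (filtration_sub FP tT) mZ).
have iX (Q : probability Om R) : Q.-integrable setT (EFin \o X).
  exact: integrable_bounded mX XM.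
have iZ (Q : probability Om R) : Q.-integrable setT (EFin \o Z).
  exact: integrable_bounded mZ' ZM.
have lbE (Q : probability Om R) (V : Om -> R) : measurable_fun setT V ->
    (forall w, `|V w| <= MX) -> - MX <= \int[Q]_w V w.
  move=> mV VM; rewrite -[leLHS](Rintegral_probability_cst Q).
  apply: le_Rintegral => //; first exact: (finite_measure_integrable_cst Q).
    exact: integrable_bounded mV VM.
  by move=> w _; have := VM w; rewrite ler_norml => /andP[].
have H := @tc (fun=> 0) (fun=> t) (stopping_time_cst FP T00) (stopping_time_cst FP tT) _ X Z _ _
  C (fun _ => Z) (fun Q _ => \int[Q]_w X w) (fun Q _ => \int[Q]_w Z w)
  Z Z (fun=> inf [set \int[Q]_w X w | Q in Qs]) (fun=> inf [set \int[Q]_w Z w | Q in Qs]).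
have {H} : {ae P, forall w : Om,
    inf [set \int[Q]_w X w | Q in Qs] <= inf [set \int[Q]_w Z w | Q in Qs]}.
  apply: H.
  - by move=> _; case/andP: tT.
  - by split=> //; exists MX; apply: aeW.
  - by split=> //; exists MX; apply: aeW.
  - by move=> Q QsQ; rewrite stopped_sigma_cst//; exact: CX.
  - by move=> Q QsQ; rewrite stopped_sigma_cst//; split.
  - by move=> Q QsQ; apply: cond_exp_trivial => //; exact: (Qeq QsQ).1.
  - by move=> Q QsQ; apply: cond_exp_trivial => //; exact: (Qeq QsQ).1.
  - exact: CZ.
  - split=> // [Q _|W' _ W'Z]; first exact: aeW.
    by have [Q0 Q0s] := Qs0; exact: (W'Z _ Q0s).
  - by apply: (@ess_inf_of_cst _ (- MX)) => Q _; exact: lbE.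
  - by apply: (@ess_inf_of_cst _ (- MX)) => Q _; exact: lbE.
  - exact: aeW.
(* The inequality does not depend on [w]; its failure would make the whole space a null set. *)
move=> [N [mN PN sub]]; rewrite leNgt; apply/negP => lt.
have : (P setT <= P N)%E.
  by apply: le_measure; rewrite ?inE// => w _; apply: sub => /=; rewrite leNgt lt.
by rewrite PN probability_setT lee_fin ler10.
Qed.

Variable f : probability Om R -> Om -> R.
Hypothesis fd : forall Q, Qs Q -> is_density P Q (f Q).
Hypothesis net : forall e : R, 0 < e ->
  exists (n : nat) (q : 'I_n -> probability Om R), (forall i, Qs (q i)) /\
    forall Q, Qs Q -> exists i, \int[P]_w `|f Q w - f (q i) w| <= e.
Hypothesis atomF : forall t : R, 0 < t <= Tend -> atomless_on P (F t).

Definition glue (B : set Om) (L N : Om -> R) w : R := L w * \1_B w + N w * \1_(~` B) w.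

Lemma glueE B L N w : glue B L N w = if w \in B then L w else N w.
Proof.
by rewrite /glue !indicE in_setC; case: (w \in B); rewrite ?mulr1 ?mulr0 ?addr0 ?add0r.
Qed.

Lemma measurable_glue B L N : measurable B -> measurable_fun setT L ->
  measurable_fun setT N -> measurable_fun setT (glue B L N).
Proof.
move=> mB mL mN; apply: measurable_funD; apply: measurable_funM => //.
by apply: measurable_indic; exact: measurableC.
Qed.

(** [N] is minus the essential supremum of the [C Q]. The sign is 1 on [B], where the infimum is
    [L], and -1 off [B], where it is [N]. *)
Lemma ess_inf_of_sign (B : set Om) (C : probability Om R -> Om -> R) (L N : Om -> R) :
  measurable B -> (forall Q w, 0 <= C Q w <= 1) ->
  ess_inf_of P Qs C L -> ess_inf_of P Qs (fun Q w => - C Q w) N ->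
  ess_inf_of P Qs (fun Q w => C Q w * sign_of B w) (glue B L N).
Proof.
move=> mB C01 [mL LC LW] [mN NC NW]; split; first exact: measurable_glue.
  move=> Q QsQ; apply: filterS2 (LC Q QsQ) (NC Q QsQ) => w lc nc.
  by rewrite glueE sign_ofE; case: ifP => _; rewrite ?mulr1 ?mulrN1.
move=> W mW WC.
(* A lower bound [W] is tested on [B] and off [B] in turn; -2 lies below all [C Q] and [- C Q], so
   it is a harmless value on the other part. *)
have m2 : measurable_fun setT (fun=> -2 : R) by [].
have h1 : {ae P, forall w, glue B W (fun=> -2) w <= L w}.
  apply: LW; first exact: measurable_glue.
  move=> Q QsQ; apply: filterS (WC Q QsQ) => w; rewrite glueE sign_ofE.
  by case: ifP => _; rewrite ?mulr1// => _; have /andP[? _] := C01 Q w; lra.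
have h2 : {ae P, forall w, glue B (fun=> -2) W w <= N w}.
  apply: NW; first exact: measurable_glue.
  move=> Q QsQ; apply: filterS (WC Q QsQ) => w; rewrite glueE sign_ofE.
  by case: ifP => _; rewrite ?mulrN1// => _; have /andP[_ ?] := C01 Q w; lra.
by apply: filterS2 h1 h2 => w; rewrite !glueE; case: ifP.
Qed.

Lemma ae_abs_cont (Q : probability Om R) (p : Om -> Prop) : abs_cont Q P ->
  {ae P, forall w, p w} -> {ae Q, forall w, p w}.
Proof. by move=> QP [N [mN PN sub]]; exists N; split=> //; exact: QP. Qed.

Lemma ae_le_Rintegral (Q : probability Om R) (g h : Om -> R) :
  Q.-integrable setT (EFin \o g) -> Q.-integrable setT (EFin \o h) ->
  {ae Q, forall w, g w <= h w} -> \int[Q]_w g w <= \int[Q]_w h w.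
Proof.
move=> ig ih gh; rewrite -subr_ge0 -RintegralB//.
have mg := integrable_measurable_fun ig; have mh := integrable_measurable_fun ih.
rewrite (_ : \int[Q]_w (h w - g w) = \int[Q]_w `|h w - g w|).
  by apply: Rintegral_ge0.
congr fine; apply: ae_eq_integral => //.
- exact/measurable_EFinP/measurable_funB.
- apply/measurable_EFinP; apply: measurableT_comp => //; exact: measurable_funB.
- by apply: filterS gh => w ? _; rewrite ger0_norm// subr_ge0.
Qed.

(** An [F t]-measurable sign can be pulled out: an event [D] is split into its parts inside and
    outside [B], both in [F t]. *)
Lemma cond_exp_sign (Q : probability Om R) t (A B : set Om) (C : Om -> R) :
  0 <= t <= Tend -> measurable A -> F t B ->
  measurable_wrt (F t) C -> (forall w, 0 <= C w <= 1) ->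
  (forall D, F t D -> (\int[Q]_(w in D) (C w)%:E = Q (A `&` D))%E) ->
  cond_exp Q (F t) (fun w => \1_A w * sign_of B w) (fun w => C w * sign_of B w).
Proof.
move=> tT mA FB mC C01 CE; have sF := filtration_sigma FP tT.
have Fm := filtration_sub FP tT; have mB := Fm _ FB.
have C1 w : `|C w| <= 1 by have /andP[h1 h2] := C01 w; rewrite ger0_norm.
have ms := measurable_sign_of (R := R) mB.
have mC' := measurable_wrt_measurable_fun Fm mC.
have iC : Q.-integrable setT (EFin \o C) by exact: integrable_bounded mC' C1.
have iA : Q.-integrable setT (EFin \o (\1_A : Om -> R)).
  apply: (integrable_bounded Q (M := 1)); first exact: measurable_indic.
  by move=> w; rewrite indicE; case: (_ \in _); rewrite ?normr1 ?normr0.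
have isg (g : Om -> R) : Q.-integrable setT (EFin \o g) ->
    Q.-integrable setT (EFin \o (fun w => g w * sign_of B w)).
  by move=> ig; apply: (integrable_mul_bounded (M := 1) ig) => // w; rewrite norm_sign_of.
split.
- apply/(measurable_wrtP sF); apply: measurable_funM; first exact/(measurable_wrtP sF).
  by apply: (@measurable_sign_of _ (g_sigma_algebraType (F t))); exact: sub_sigma_algebra.
- exact: isg.
move=> D FD; have mD := Fm _ FD.
have fin (g : Om -> R) : Q.-integrable setT (EFin \o g) ->
    (\int[Q]_(w in D) (g w * sign_of B w)%:E =
     (\int[Q]_(w in D) (g w * sign_of B w))%:E)%E.
  move=> ig; rewrite /Rintegral fineK//; apply: (@integrable_fin_num _ _ _ Q D) => //.
  by apply: (@integrableS _ _ _ Q setT) => //; exact: isg.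
rewrite (fin _ iC) (fin _ iA) !Rintegral_sign_of//; congr (_ - _)%:E.
- have FDB : F t (D `&` B) by exact: salgebra_setI.
  by rewrite Rintegral_indic_setI//; [rewrite /Rintegral CE|exact: Fm].
- have FDB : F t (D `&` ~` B) by apply: salgebra_setI => //; exact: salgebra_setC.
  by rewrite Rintegral_indic_setI//; [rewrite /Rintegral CE|exact: Fm].
Qed.

(* Testing consistency on [1_A * r], with [r = +-1] measurable at time [t] and nearly
   independent of everything relevant, forces the essential infimum [L] and supremum
   [-N] of the conditional probabilities of [A] to agree. *)
Lemma common_conditional_probability (t : R) (A : set Om) : 0 < t <= Tend -> measurable A ->
  exists L : Om -> R, [/\ measurable_wrt (F t) L, (forall w, 0 <= L w <= 1) &
    forall Q, Qs Q -> \int[Q]_w L w = fine (Q A)].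
Proof.
move=> /[dup] tT' /andP[/ltW t0 tT0] mA.
have tT : 0 <= t <= Tend by rewrite t0.
have sF := filtration_sigma FP tT; have Fm := filtration_sub FP tT.
have /choice[C CP] : forall Q : probability Om R, exists C : Om -> R,
    [/\ measurable_wrt (F t) C, (forall w, 0 <= C w <= 1) &
    forall B, F t B -> (\int[Q]_(w in B) (C w)%:E = Q (A `&` B))%E].
  by move=> Q; exact: cond_exp_indic_exists.
have C01 Q w : 0 <= C Q w <= 1 by have [_ + _] := CP Q; exact.
have mCQ Q : measurable_wrt (F t) (C Q) by have [] := CP Q.
have mC Q : measurable_fun setT (C Q) by exact: (measurable_wrt_measurable_fun Fm).
have [L [mL L01 LE]] := ess_inf_exists sF Fm P Qs0 (fun Q _ => mCQ Q) (fun Q w _ => C01 Q w).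
have [N [mN N01 NE]] : exists W, [/\ measurable_wrt (F t) W, (forall w, -1 <= W w <= 0) &
    ess_inf_of P Qs (fun Q w => - C Q w) W].
  apply: (ess_inf_exists sF Fm P Qs0) => [Q _|Q w _].
    by apply/(measurable_wrtP sF)/measurable_funN/(measurable_wrtP sF).
  by have /andP[h1 h2] := C01 Q w; apply/andP; split; lra.
exists L; split=> // Q1 Q1s.
have mL' := measurable_wrt_measurable_fun Fm mL.
have mN' := measurable_wrt_measurable_fun Fm mN.
have nb (g : Om -> R) : (forall w, 0 <= g w <= 1) -> forall w, `|g w| <= 1.
  by move=> g01 w; have /andP[h1 h2] := g01 w; rewrite ger0_norm.
have N1 w : `|N w| <= 1 by have /andP[h1 h2] := N01 w; rewrite ler_norml h1; lra.
have iL (Q : probability Om R) : Q.-integrable setT (EFin \o L).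
  by apply: (integrable_bounded Q (M := 1)) => //; exact: nb.
have iN (Q : probability Om R) : Q.-integrable setT (EFin \o N).
  by apply: (integrable_bounded Q (M := 1)).
have iC (Q Q' : probability Om R) : Q'.-integrable setT (EFin \o C Q).
  by apply: (integrable_bounded Q' (M := 1)) => //; exact: nb.
have CA : \int[Q1]_w C Q1 w = fine (Q1 A).
  have [_ _ /(_ setT)] := CP Q1; rewrite setIT /Rintegral => -> //.
  exact: salgebra_setT.
have QP := (Qeq Q1s).1.
have LC : \int[Q1]_w L w <= \int[Q1]_w C Q1 w.
  by apply: ae_le_Rintegral => //; apply: ae_abs_cont QP _; have [_ + _] := LE; exact.
have NC : \int[Q1]_w N w <= - \int[Q1]_w C Q1 w.
  rewrite -mulN1r -RintegralZl//; last exact: iC.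
  apply: (@ae_le_Rintegral Q1 N (fun w => -1 * C Q1 w)) => //.
    exact: (integrable_scale (-1) (iC Q1 Q1)).
  apply: ae_abs_cont QP _; have [_ /(_ _ Q1s) + _] := NE.
  by apply: filterS => w; rewrite mulN1r.
(* In mean under [Q1], [L <= C Q1 <= - N]. The reverse comparison of [- N] with [L] forces equality,
   and [C Q1] has mean [Q1 A]. *)
suff : 0 <= \int[Q1]_w L w + \int[Q1]_w N w by lra.
(* Net and mixing cost [e / 6] each in the bound for [X], doubled by the factor [1 / 2] in [ZE]; the
   mixing term of [ZE] adds [e / 6], making [5 e / 6]. *)
apply/ler_addgt0Pr => e e0; have e6 : 0 < e / 6 by rewrite divr_gt0.
have [n [q [qs qP]]] := net e6.
have mI : measurable_fun setT (\1_A : Om -> R) by exact: measurable_indic.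
have I1 w : `|\1_A w : R| <= 1.
  by rewrite indicE; case: (_ \in _); rewrite ?normr1 ?normr0.
have iLN (Q : probability Om R) := integrable_sub (iL Q) (iN Q).
(* One event [B] must serve all requirements: index 0 stands for [L - N] under [Q1], the others for
   [1_A] under the measures of the net. *)
pose h (k : 'I_n.+1) : Om -> R := if unlift ord0 k is Some i
  then (fun w => \1_A w * f (q i) w) else (fun w => (L w - N w) * f Q1 w).
have ih k : P.-integrable setT (EFin \o h k).
  rewrite /h; case: (unlift _ _) => [i|]; apply: integrable_density.
  - exact: fd.
  - exact: integrable_bounded mI I1.
  - exact: fd.
  - exact: iLN.
have [B FB Bmix] := mixing_integrable sF Fm (atomF tT') e6 ih.
have mB := Fm _ FB; have ms := measurable_sign_of (R := R) mB.
pose X w : R := \1_A w * sign_of B w.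
have mX : measurable_fun setT X by exact: measurable_funM.
have X1 w : `|X w| <= 1 by rewrite normrM norm_sign_of mulr1.
pose Z := glue B L N.
have Z1 w : `|Z w| <= 1 by rewrite /Z glueE; case: ifP => _ //; exact: nb.
have mZ : measurable_wrt (F t) Z.
  apply/(measurable_wrtP sF); apply: measurable_funD; apply: measurable_funM.
  - exact/(measurable_wrtP sF).
  - by apply: measurable_indic; exact: sub_sigma_algebra.
  - exact/(measurable_wrtP sF).
  - by apply: measurable_indic; apply: sub_sigma_algebra; exact: salgebra_setC.
have mZ' := measurable_wrt_measurable_fun Fm mZ.
have iZ (Q : probability Om R) : Q.-integrable setT (EFin \o Z).
  exact: integrable_bounded mZ' Z1.
have XZ : inf [set \int[Q]_w X w | Q in Qs] <= inf [set \int[Q]_w Z w | Q in Qs].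
  apply: (@time_consistent_expectation t X Z (fun Q w => C Q w * sign_of B w) 1) => //.
    by move=> Q QsQ; have [h1 h2 h3] := CP Q; exact: cond_exp_sign.
  exact: ess_inf_of_sign.
have Xlow : - (e / 6 + e / 6) <= inf [set \int[Q]_w X w | Q in Qs].
  apply: lb_le_inf; first by exists (\int[Q1]_w X w), Q1.
  move=> _ [Q QsQ <-]; have [i Qi] := qP _ QsQ.
  have := Rintegral_density_close (fd QsQ) (fd (qs i)) mX X1; rewrite mul1r.
  have := Bmix (lift ord0 i); rewrite /h liftK.
  have -> : \int[P]_w (\1_A w * f (q i) w * sign_of B w) = \int[q i]_w X w.
    by rewrite (Rintegral_density (fd (qs i)) mX); apply: eq_Rintegral => w _; rewrite mulrAC.
  by rewrite !ler_norml => /andP[? ?] /andP[? ?]; lra.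
have Zup : inf [set \int[Q]_w Z w | Q in Qs] <= \int[Q1]_w Z w.
  apply: ge_inf; last by exists Q1.
  exists (-1) => _ [Q QsQ <-]; rewrite -[leLHS](Rintegral_probability_cst Q).
  apply: le_Rintegral => //; [exact: (finite_measure_integrable_cst Q)|exact: iZ|].
  by move=> w _; have := Z1 w; rewrite ler_norml => /andP[].
have iLNs : Q1.-integrable setT (EFin \o (fun w => (L w - N w) * sign_of B w)).
  by apply: (integrable_mul_bounded (M := 1) (iLN Q1)) => // w; rewrite norm_sign_of.
(* With [r] the sign of [B], gluing [L] and [N] gives half of [(L - N) r + (L + N)]. *)
have ZE : \int[Q1]_w Z w = 2^-1 * (\int[Q1]_w ((L w - N w) * sign_of B w) +
    (\int[Q1]_w L w + \int[Q1]_w N w)).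
  have iLpN := integrable_add (iL Q1) (iN Q1).
  rewrite -(RintegralD _ (iL Q1) (iN Q1))// -(RintegralD _ iLNs iLpN)//.
  rewrite -RintegralZl//; last exact: integrable_add.
  apply: eq_Rintegral => w _; rewrite /Z glueE sign_ofE.
  by case: ifP => _; lra.
have := Bmix ord0; rewrite /h unlift_none.
have -> : \int[P]_w ((L w - N w) * f Q1 w * sign_of B w) =
    \int[Q1]_w ((L w - N w) * sign_of B w).
  rewrite (Rintegral_density (fd Q1s)); last exact: integrable_measurable_fun iLNs.
  by apply: eq_Rintegral => w _; rewrite mulrAC.
rewrite ler_norml => /andP[_ hs].
move: (le_trans Xlow (le_trans XZ Zup)); rewrite ZE; lra.
Qed.

(* As in the Neyman-Pearson lemma, [(1_A - L) * (f Q2 - f Q1) >= 0] for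
   [A = {f Q1 < f Q2}], while its integral vanishes because [L] and [1_A] have the same
   expectation under [Q1] and [Q2]. *)
Lemma separating_set (t : R) (Q1 Q2 : probability Om R) : 0 < t <= Tend ->
  Qs Q1 -> Qs Q2 -> exists2 B, F t B &
    {ae P, forall w, (f Q1 w < f Q2 w -> B w) /\ (f Q2 w < f Q1 w -> ~ B w)}.
Proof.
move=> /[dup] tT' /andP[/ltW t0 tT0] Q1s Q2s.
have tT : 0 <= t <= Tend by rewrite t0.
have Fm := filtration_sub FP tT; have sF := filtration_sigma FP tT.
have i1 := density_integrable (fd Q1s); have i2 := density_integrable (fd Q2s).
have m1 := integrable_measurable_fun i1; have m2 := integrable_measurable_fun i2.
pose A := [set w | f Q1 w < f Q2 w].
have mA : measurable A by exact: measurable_set_lt.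
have [L [mL L01 LE]] := common_conditional_probability tT' mA.
have mL' := measurable_wrt_measurable_fun Fm mL.
have mI : measurable_fun setT (\1_A : Om -> R) by exact: measurable_indic.
pose g w : R := \1_A w - L w.
have mg : measurable_fun setT g by exact: measurable_funB.
have ind w : \1_A w = ((f Q1 w < f Q2 w)%R)%:R :> R.
  rewrite indicE; congr (nat_of_bool _)%:R; apply/idP/idP; first by move/set_mem.
  by move=> ?; rewrite mem_set.
have g1 w : `|g w| <= 1.
  have /andP[h1 h2] := L01 w; rewrite /g ind ler_norml.
  by case: (_ < _) => /=; apply/andP; split; lra.
have I1 w : `|\1_A w : R| <= 1.
  by rewrite ind; case: (_ < _); rewrite ?normr1 ?normr0.
have L1 w : `|L w| <= 1 by have /andP[h1 h2] := L01 w; rewrite ger0_norm.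
have gQ Q : Qs Q -> \int[Q]_w g w = 0.
  move=> QsQ; rewrite RintegralB//.
  - by rewrite LE// /Rintegral integral_indic// setIT subrr.
  - exact: integrable_bounded mI I1.
  - exact: integrable_bounded mL' L1.
pose k w := g w * f Q2 w - g w * f Q1 w.
have ik1 := integrable_density (fd Q1s) (integrable_bounded Q1 mg g1).
have ik2 := integrable_density (fd Q2s) (integrable_bounded Q2 mg g1).
have ik : P.-integrable setT (EFin \o k) by exact: integrable_sub.
have kE w : k w = g w * (f Q2 w - f Q1 w) by rewrite /k; ring.
have k0 w : 0 <= k w.
  rewrite kE /g ind; have /andP[h1 h2] := L01 w; case: ltP => h /=; nra.
have kI : \int[P]_w k w = 0.
  rewrite RintegralB// -(Rintegral_density (fd Q1s) mg) -(Rintegral_density (fd Q2s) mg).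
  by rewrite !gQ// subrr.
have : ae_eq P setT (EFin \o k) (cst 0%E).
  apply/ae_eq_integral_abs => //.
    exact/measurable_EFinP/(integrable_measurable_fun ik).
  transitivity ((\int[P]_w k w)%:E); last by rewrite kI.
  by rewrite EFin_Rintegral//; apply: eq_integral => w _; rewrite /= ger0_norm.
(* Where the densities differ, [L] equals [1_A] almost surely, so the level 1/2 separates its values
   0 and 1. *)
move=> aek; exists [set w | 2^-1 <= L w].
  have := mL _ (measurable_itv `[2^-1, +oo[).
  by congr (F t); apply/seteqP; split=> w /=; rewrite in_itv/= andbT.
apply: filterS aek => w /(_ Logic.I) /= [] /eqP; rewrite kE mulf_eq0 /g ind => /orP[|/eqP h].
  rewrite subr_eq0 => /eqP h; split=> h'.
    by rewrite -h h'/=; lra.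
  rewrite -h (_ : _ < _ = false)/=; first by apply/negP; rewrite -ltNge; lra.
  by apply/negbTE; rewrite -leNgt ltW.
by split=> h'; move: h'; rewrite -subr_gt0 ?h ?ltxx// -opprB h oppr0 ltxx.
Qed.

End consistency_identity.
End time_consistency.

(** The order of the densities gives [Q2 <= Q1] on [A] and on its complement; as both masses are 1,
    neither inequality can be strict. *)
Lemma ae_le_density_eq {d : measure_display} {Om : measurableType d} {R : realType}
    (P Q1 Q2 : probability Om R) (f1 f2 : Om -> R) :
  is_density P Q1 f1 -> is_density P Q2 f2 -> {ae P, forall w, f2 w <= f1 w} ->
  forall A, measurable A -> Q1 A = Q2 A.
Proof.
move=> d1 d2 f21; have [m1 f10 Q1E] := d1; have [m2 f20 Q2E] := d2.
have le A : measurable A -> (Q2 A <= Q1 A)%E.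
  move=> mA; rewrite Q1E// Q2E//; apply: ae_ge0_le_integral => //.
  - by move=> w _; rewrite lee_fin.
  - exact/measurable_funTS/measurable_EFinP.
  - by move=> w _; rewrite lee_fin.
  - exact/measurable_funTS/measurable_EFinP.
  - by apply: filterS f21 => w ? _; rewrite lee_fin.
move=> A mA; apply/eqP; rewrite eq_le le// andbT.
have := le _ (measurableC mA); rewrite !probability_setC//.
rewrite -(fineK_probability Q1 mA) -(fineK_probability Q2 mA) -!EFinB !lee_fin.
by rewrite lerD2l lerN2.
Qed.

(** * The limit at time 0 and the failure of time-consistency *)

Section not_time_consistent.
Context {d : measure_display} {Om : measurableType d} {R : realType}.
Variables (P : probability Om R) (Tend : R) (F : R -> set (set Om)).
Hypothesis T0 : 0 < Tend.
Hypothesis FP : usual_filtration P Tend F.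

(** An upper limit depends only on the tail of the sequence, so it lies in [F s] for every [s > 0],
    and right-continuity puts it in [F 0]. *)
Lemma limsup_germ (B : nat -> set Om) :
  (forall n : nat, F (Tend / n.+1%:R) (B n)) ->
  F 0 (\bigcap_k \bigcup_n B (k + n)%N).
Proof.
move=> FB; have [_ _ _ rcF _] := FP; rewrite (rcF 0); last by rewrite lexx.
move=> s /= /andP[s0 sT]; have sT' : 0 <= s <= Tend by rewrite (ltW s0).
have [K KP] : exists K : nat, forall n, (K <= n)%N -> Tend / n.+1%:R <= s.
  have : (fun n => Tend / n.+1%:R) @ \oo --> (0 : R).
    by rewrite -(mulr0 Tend); apply: cvgMr; exact: cvg_harmonic.
  move=> /cvgrPdist_le/(_ _ s0)[K _ KP]; exists K => n /KP /=.
  by rewrite sub0r normrN; apply: le_trans; exact: ler_norm.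
rewrite (_ : \bigcap_k _ = \bigcap_k \bigcup_n B (K + k + n)%N).
  apply: (salgebra_bigcap (filtration_sigma FP sT')) => k.
  apply: (salgebra_bigcup (filtration_sigma FP sT')) => n.
  apply: (filtration_mono FP _ (KP (K + k + n)%N _) sT) => //.
    by rewrite divr_ge0// ltW.
  by rewrite -addnA leq_addr.
apply/seteqP; split=> w Bw k _; first exact: Bw.
have [n _ Bn] := Bw k Logic.I; exists (K + n)%N => //.
by rewrite addnCA addnA.
Qed.

Variables (Qs : set (probability Om R)) (f : probability Om R -> Om -> R).
Hypothesis Qeq : forall Q, Qs Q -> equiv_meas Q P.
Hypothesis fd : forall Q, Qs Q -> is_density P Q (f Q).
Hypothesis net : forall e : R, 0 < e ->
  exists (n : nat) (q : 'I_n -> probability Om R), (forall i, Qs (q i)) /\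
    forall Q, Qs Q -> exists i, \int[P]_w `|f Q w - f (q i) w| <= e.
Hypothesis atomF : forall t : R, 0 < t <= Tend -> atomless_on P (F t).

(** The upper limit [L] of separating events at times [Tend / (n + 1)] still separates and has
    probability 0 or 1. Either case orders the two densities almost surely, so the measures
    coincide. *)
Lemma not_time_consistent (Q1 Q2 : probability Om R) A :
  Qs Q1 -> Qs Q2 -> measurable A -> Q1 A <> Q2 A -> ~ time_consistent P Tend F Qs.
Proof.
move=> Q1s Q2s mA Q12 tc.
have tT (n : nat) : 0 < Tend / n.+1%:R <= Tend.
  by rewrite divr_gt0//= ler_pdivrMr// ler_peMr ?(ltW T0)// ler1n.
have Qs0 : exists Q, Qs Q by exists Q1.
have /choice[B BP] : forall n : nat, exists B, F (Tend / n.+1%:R) B /\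
    {ae P, forall w, (f Q1 w < f Q2 w -> B w) /\ (f Q2 w < f Q1 w -> ~ B w)}.
  move=> n; have [B FB Bae] := separating_set T0 FP Qeq Qs0 tc fd net atomF (tT n) Q1s Q2s.
  by exists B.
pose L := \bigcap_k \bigcup_n B (k + n)%N.
have FL : F 0 L by apply: limsup_germ => n; exact: (BP n).1.
have T00 : 0 <= (0 : R) <= Tend by rewrite lexx ltW.
have mL : measurable L by exact: (filtration_sub FP T00).
have Lae : {ae P, forall w, (f Q1 w < f Q2 w -> L w) /\ (f Q2 w < f Q1 w -> ~ L w)}.
  have : {ae P, forall w, forall n, (f Q1 w < f Q2 w -> B n w) /\ (f Q2 w < f Q1 w -> ~ B n w)}.
    by apply/ae_foralln => n; exact: (BP n).2.
  apply: filterS => w Bw; split=> [lt k _|lt].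
    by exists 0%N => //; exact: (Bw _).1.
  by move=> /(_ 0%N Logic.I)[n _]; exact: (Bw _).2.
have [_ _ _ _ [_ F01 _]] := FP; apply: Q12.
have aeC (D : set Om) : measurable D -> P D = 0%E -> {ae P, forall w, ~ D w}.
  by move=> mD PD; exists D; split=> // w /= /contrapT.
have [PL|PL] := F01 L FL.
  apply: (ae_le_density_eq (fd Q1s) (fd Q2s)) => //.
  apply: filterS2 Lae (aeC L mL PL) => w [h _] nL.
  by rewrite leNgt; apply/negP => /h.
apply/esym/(ae_le_density_eq (fd Q2s) (fd Q1s)) => //.
have PLC : P (~` L) = 0%E by rewrite probability_setC// PL subee.
apply: filterS2 Lae (aeC _ (measurableC mL) PLC) => w [_ h] nL.
by rewrite leNgt; apply/negP => /h/nL.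
Qed.

End not_time_consistent.

Unset Implicit Arguments.

Theorem theorem2p3 (d : measure_display) (Om : measurableType d) (R : realType)
  (P : probability Om R) (Tend : R) (F : R -> set (set Om))
  (Qs : set (probability Om R)) (Y : R -> Om -> R)
  (dist : probability Om R -> probability Om R -> R) :
  0 < Tend ->
  usual_filtration P Tend F ->
  (exists Q, Qs Q) ->
  (forall Q, Qs Q -> abs_cont Q P) ->
  (* Y adapted, right-continuous, with bounded paths *)
  (forall t, 0 <= t <= Tend -> measurable_wrt (F t) (Y t)) ->
  (forall w t, 0 <= t < Tend -> (fun s => Y s w) @ at_right t --> Y t w) ->
  (forall w, exists M : R, forall t, 0 <= t <= Tend -> `|Y t w| <= M) ->
  (* quasi left-uppersemicontinuity w.r.t. P *)
  (forall (taun : nat -> Om -> R) (tau : Om -> R),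
     (forall n, stopping_time Tend F (taun n)) -> stopping_time Tend F tau ->
     (forall w, {homo (fun n => taun n w) : m n / (m <= n)%N >-> m <= n}) ->
     (forall w, (fun n => taun n w) @ \oo --> tau w) ->
     {ae P, forall w,
        (limn_esup (fun n => (Y (taun n w) w)%:E) <= (Y (tau w) w)%:E)%E}) ->
  (* atomless *)
  (forall t, 0 < t <= Tend -> atomless_on P (F t)) ->
  (* Y^* in L^1(Qs) and uniform integrability *)
  (exists M : R, forall Q, Qs Q -> ('E_Q[Ystar Tend Y]%E <= M%:E)%E) ->
  (fun a : R => ereal_sup
     [set 'E_Q[(fun w => Ystar Tend Y w * (\1_[set w' | a < Ystar Tend Y w'] w))%R]%E
        | Q in Qs]) @ +oo --> 0%E ->
  (* d totally bounded semimetric, densities d-uniformly continuous and dominated *)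
  semimetric_on Qs dist -> totally_bounded_on Qs dist ->
  (exists (f : probability Om R -> Om -> R) (G : Om -> R),
     [/\ (forall Q, Qs Q -> is_density P Q (f Q)),
         P.-integrable setT (EFin \o G) &
         {ae P, forall w,
            (forall eps : R, 0 < eps -> exists2 delta : R, 0 < delta &
               forall Q1 Q2, Qs Q1 -> Qs Q2 -> dist Q1 Q2 < delta ->
                 `|f Q1 w - f Q2 w| < eps) /\
            (forall Q, Qs Q -> `|f Q w| <= G w)}]) ->
  (ereal_sup [set ereal_inf [set 'E_Q[stopped Y tau]%E | Q in Qs]
                | tau in stopping_time Tend F]
   = ereal_sup [set ereal_inf [set 'E_Q[stopped Y tau]%E | Q in conv_hull Qs]
                | tau in stopping_time Tend F]
   /\
   ereal_sup [set ereal_inf [set 'E_Q[stopped Y tau]%E | Q in conv_hull Qs]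
                | tau in stopping_time Tend F]
   = ereal_inf [set ereal_sup [set 'E_Q[stopped Y tau]%E
                                 | tau in stopping_time Tend F]
                | Q in conv_hull Qs])
  /\
  ((forall t, 0 < t <= Tend -> weakly_separable_L1 P (F t)) ->
   (exists Q1 Q2, [/\ Qs Q1, Qs Q2 & exists A, measurable A /\ Q1 A <> Q2 A]) ->
   (forall Q, Qs Q -> equiv_meas Q P) ->
   ~ time_consistent P Tend F Qs).
Proof.
move=> T0 FP Qs0 _ adY rcY bY _ atomF [M YM] ui _ tb [f [G [fd iG fG]]].
split; last first.
  move=> _ [Q1 [Q2 [Q1s Q2s [A [mA Q12]]]]] Qeq.
  by apply: (not_time_consistent T0 FP Qeq fd (density_L1_net tb fd iG fG) atomF Q1s Q2s mA Q12).
apply: (robust_stopping_minimax T0 FP fd adY rcY bY YM atomF Qs0).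
(* Payoffs are unbounded, so the [L^1] net of densities is upgraded by uniform integrability to one
   controlling every variable dominated by [Ystar]. *)
move=> e e0; apply: (uniformly_integrable_net tb fd iG fG) => //.
- exact: adapted_measurable_Ystar T0 FP adY rcY bY.
- exact: integrable_Ystar T0 FP adY rcY bY _ YM.
Qed.
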